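(* Let $M$ be a smooth $3$-manifold, $\nabla$ a torsion-free connection on $TM$ with projective Weyl tensor $W_{ab}{}^c{}_d$, and $\epsilon^{abc}$ an arbitrarily chosen nowhere-vanishing section of $\Lambda^3(TM)$. Put $V^{ab}{}_c=\epsilon^{dea}W_{de}{}^b{}_c$ (which satisfies $V^{ab}{}_c=V^{(ab)}{}_c$ and $V^{ab}{}_a=0$). Let $A,B,C,D,F,J,K,L$ be the symmetric tensors $$A^{ab}=\bigodot(V^{ap}{}_qV^{bq}{}_p),\quad B^{abc}=\bigodot(V^{ap}{}_qV^{bq}{}_rV^{cr}{}_p),\quad C^{abc}=\bigodot(V^{ab}{}_pV^{pq}{}_rV^{cr}{}_q),$$ $$D^{abcd}=\bigodot(V^{ab}{}_pV^{pq}{}_rV^{cr}{}_sV^{ds}{}_q),\quad F^{abcd}=\bigodot(V^{ab}{}_pV^{cd}{}_qV^{pr}{}_sV^{qs}{}_r),$$ $$J^{abcdef}=\bigodot(V^{ab}{}_pV^{cd}{}_qV^{pq}{}_rV^{er}{}_sV^{st}{}_uV^{fu}{}_t),$$ $$K^{abcdef}=\bigodot(V^{ab}{}_pV^{cd}{}_qV^{ep}{}_rV^{fq}{}_sV^{rt}{}_uV^{su}{}_t),$$ $$L^{abcdef}=\bigodot(V^{ab}{}_pV^{cd}{}_qV^{pq}{}_rV^{rs}{}_tV^{et}{}_uV^{fu}{}_s),$$ where $\bigodot$ denotes symmetrisation over the non-contracted indices, and let $$T=24J+12K-24L-24\,B\odot B-24\,C\odot C+40\,B\odot C-24\,A\odot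 D+6\,A\odot F .$$ In general the tensor $T^{abcdef}$ does not vanish, i.e. there exist a smooth $3$-manifold $M$ (with a nowhere-vanishing section $\epsilon^{abc}$ of $\Lambda^3(TM)$) and a torsion-free connection $\nabla$ on $TM$ for which $T$ is not identically zero. However, if $\nabla$ is projectively equivalent to the Levi-Civita connection of some (pseudo-)Riemannian metric on $M$, then $T^{abcdef}\equiv 0$.
   Context: Abstract index notation is used; a repeated index denotes contraction, round brackets on indices denote symmetrisation, square brackets skew-symmetrisation. For symmetric contravariant tensors $P,Q$, $P\odot Q$ is the symmetrised tensor product, e.g. $(B\odot C)^{abcdef}=B^{(abc}C^{def)}$. Torsion-free connections $\nabla,\hat\nabla$ on $TM$ are projectively equivalent if there is a $1$-form $\Upsilon_a$ with $\hat\nabla_aX^b=\nabla_aX^b+\Upsilon_aX^b+\delta_a{}^b\Upsilon_cX^c$ (equivalently, they have the same unparametrised geodesics). The curvature is defined by $[\nabla_a,\nabla_b]X^c=R_{ab}{}^c{}_dX^d$. It decomposes uniquely as $R_{ab}{}^c{}_d=W_{ab}{}^c{}_d+\delta_a{}^c\mathrm{P}_{bd}-\delta_b{}^c\mathrm{P}_{ad}+\beta_{ab}\delta_d{}^c$ with $\beta_{ab}=-2\mathrm{P}_{[ab]}$ and $W_{ab}{}^c{}_d$ totally trace-free; $W_{ab}{}^c{}_d$ is the projective Weyl tensor. It depends only on the projective class of $\nabla$ and satisfies $W_{ab}{}^c{}_d=W_{[ab]}{}^c{}_d$, $W_{[ab}{}^c{}_{d]}=0$, $W_{ab}{}^a{}_d=0$.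 *)

(* Defs.v *)
From HB Require Import structures.
From mathcomp Require Import all_boot all_order all_algebra all_fingroup.
From mathcomp Require Import all_classical all_reals all_analysis.

Set Implicit Arguments.
Unset Strict Implicit.
Unset Printing Implicit Defensive.

Import Order.TTheory GRing.Theory Num.Theory.
Import numFieldNormedType.Exports.

Local Open Scope classical_set_scope.
Local Open Scope ring_scope.

Section Smooth.
Variable R : realType.
Implicit Types (U : set 'rV[R]_3) (f : 'rV[R]_3 -> R).

Definition partial (a : 'I_3) f : 'rV[R]_3 -> R :=
  fun x => 'D_(delta_mx 0 a : 'rV[R]_3) f x.

(* Meant for open U; the values of f outside U are then irrelevant. *)
Fixpoint Cn_on (n : nat) U f : Prop :=
  (forall x, U x -> {for x, continuous f}) /\
  match n with
  | 0%N => True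
  | n'.+1 => forall a : 'I_3,
      (forall x, U x -> derivable f x (delta_mx 0 a : 'rV[R]_3)) /\
      Cn_on n' U (partial a f)
  end.

Definition smooth_on U f : Prop := forall n, Cn_on n U f.

End Smooth.

(* A smooth 3-manifold given by a (not necessarily maximal) smooth atlas.
   The chart i is the homeomorphism coord i from the open set dom i of M onto
   the open set cod i of R^3, with inverse param i. *)
Record manifold3 (R : realType) := Manifold3 {
  carrier :> topologicalType;
  carrier_hausdorff : hausdorff_space carrier;
  carrier_second_countable : @second_countable carrier;
  chart : Type;
  dom : chart -> set carrier;
  cod : chart -> set 'rV[R]_3;
  coord : chart -> carrier -> 'rV[R]_3;
  param : chart -> 'rV[R]_3 -> carrier;
  open_dom : forall i, open (dom i);
  open_cod : forall i, open (cod i);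
  coord_cod : forall i p, dom i p -> cod i (coord i p);
  param_dom : forall i x, cod i x -> dom i (param i x);
  coordK : forall i p, dom i p -> param i (coord i p) = p;
  paramK : forall i x, cod i x -> coord i (param i x) = x;
  coord_continuous : forall i p, dom i p -> {for p, continuous (coord i)};
  param_continuous : forall i x, cod i x -> {for x, continuous (param i)};
  dom_cover : forall p, exists i, dom i p;
  transition_smooth : forall i j (a : 'I_3),
    smooth_on [set x | cod i x /\ dom j (param i x)]
              (fun x => coord j (param i x) 0 a)
}.

Section Tensors.
Variables (R : realType) (M : manifold3 R).

Definition overlap (i j : chart M) : set 'rV[R]_3 :=
  [set x | cod i x /\ dom j (param i x)].

Definition transition (i j : chart M) (x : 'rV[R]_3) : 'rV[R]_3 :=
  coord j (param i x).

(* With x the coordinates of the chart i and y those of the chart j,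
   jac i j x a b is dy^a/dx^b and hess i j x a b c is d^2y^a/dx^b dx^c. *)
Definition jac (i j : chart M) (x : 'rV[R]_3) (a b : 'I_3) : R :=
  partial b (fun z => transition i j z 0 a) x.

Definition hess (i j : chart M) (x : 'rV[R]_3) (a b c : 'I_3) : R :=
  partial b (partial c (fun z => transition i j z 0 a)) x.

(* Tensor fields are families of components, one for each chart i, as functions
   of the coordinates of that chart (relevant on cod i only), related by the
   usual transformation law on overlaps. *)

Record oneform := OneForm {
  oneform_comp :> chart M -> 'rV[R]_3 -> 'I_3 -> R;
  oneform_smooth : forall i a,
    smooth_on (cod i) (fun x => oneform_comp i x a);
  oneform_law : forall i j x a, overlap i j x ->
    oneform_comp i x a =
    \sum_b oneform_comp j (transition i j x) b * jac i j x b a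
}.

(* Nowhere-vanishing sections of Lambda^3(TM). *)
Record volume_trivector := VolumeTrivector {
  trivector_comp :> chart M -> 'rV[R]_3 -> 'I_3 -> 'I_3 -> 'I_3 -> R;
  trivector_smooth : forall i a b c,
    smooth_on (cod i) (fun x => trivector_comp i x a b c);
  trivector_law : forall i j x a b c, overlap i j x ->
    trivector_comp j (transition i j x) a b c =
    \sum_d \sum_e \sum_f
      jac i j x a d * jac i j x b e * jac i j x c f * trivector_comp i x d e f;
  trivector_skew12 : forall i x a b c, cod i x ->
    trivector_comp i x b a c = - trivector_comp i x a b c;
  trivector_skew23 : forall i x a b c, cod i x ->
    trivector_comp i x a c b = - trivector_comp i x a b c;
  trivector_neq0 : forall i x, cod i x ->
    exists a b c, trivector_comp i x a b c != 0
}.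

(* Metrics of arbitrary signature. *)
Record metric := Metric {
  metric_comp :> chart M -> 'rV[R]_3 -> 'I_3 -> 'I_3 -> R;
  metric_smooth : forall i a b,
    smooth_on (cod i) (fun x => metric_comp i x a b);
  metric_law : forall i j x a b, overlap i j x ->
    metric_comp i x a b =
    \sum_c \sum_d
      metric_comp j (transition i j x) c d * jac i j x c a * jac i j x d b;
  metric_sym : forall i x a b, cod i x ->
    metric_comp i x a b = metric_comp i x b a;
  metric_nondegenerate : forall i x, cod i x ->
    \matrix_(a < 3, b < 3) metric_comp i x a b \in unitmx
}.

(* Connections on TM, given by their Christoffel symbols:
   christoffel i x a b c is Gamma_{ab}^c, where
   nabla_a X^c = d_a X^c + Gamma_{ab}^c X^b in the chart i. *)
Record connection := Connection {
  christoffel :> chart M -> 'rV[R]_3 -> 'I_3 -> 'I_3 -> 'I_3 -> R;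
  christoffel_smooth : forall i a b c,
    smooth_on (cod i) (fun x => christoffel i x a b c);
  christoffel_law : forall i j x a b f, overlap i j x ->
    \sum_c jac i j x f c * christoffel i x a b c =
    hess i j x f a b +
    \sum_d \sum_e christoffel j (transition i j x) d e f
                  * jac i j x d a * jac i j x e b
}.

Definition torsion_free (N : connection) : Prop :=
  forall i x a b c, cod i x -> N i x a b c = N i x b a c.

(* Vector fields over the domain of the chart i, in coordinates. *)
Definition smooth_vector (i : chart M) (X : 'rV[R]_3 -> 'I_3 -> R) : Prop :=
  forall c, smooth_on (cod i) (fun x => X x c).

(* nabla_a X^c *)
Definition nabla_vect (N : connection) (i : chart M)
    (X : 'rV[R]_3 -> 'I_3 -> R) (x : 'rV[R]_3) (a c : 'I_3) : R :=
  partial a (fun z => X z c) x + \sum_b N i x a b c * X x b.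

(* nabla_a Y_b^c *)
Definition nabla_endo (N : connection) (i : chart M)
    (Y : 'rV[R]_3 -> 'I_3 -> 'I_3 -> R) (x : 'rV[R]_3) (a b c : 'I_3) : R :=
  partial a (fun z => Y z b c) x
  + \sum_e N i x a e c * Y x b e - \sum_e N i x a b e * Y x e c.

(* nabla_a g_{bc} *)
Definition nabla_metric (N : connection) (g : metric) (i : chart M)
    (x : 'rV[R]_3) (a b c : 'I_3) : R :=
  partial a (fun z => g i z b c) x
  - \sum_d N i x a b d * g i x d c - \sum_d N i x a c d * g i x b d.

Definition levi_civita (g : metric) (N : connection) : Prop :=
  torsion_free N /\
  forall i x a b c, cod i x -> nabla_metric N g i x a b c = 0.

Definition kron (a b : 'I_3) : R := (a == b)%:R.

Definition projectively_equivalent (N N' : connection) : Prop :=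
  exists Y : oneform, forall i X, smooth_vector i X ->
    forall x a b, cod i x ->
      nabla_vect N' i X x a b =
      nabla_vect N i X x a b + Y i x a * X x b
      + kron a b * \sum_c Y i x c * X x c.

(* Rm i x a b c d is R_{ab}^c_d, characterised by
   [nabla_a, nabla_b] X^c = R_{ab}^c_d X^d (for a torsion-free connection). *)
Definition is_curvature (N : connection)
    (Rm : chart M -> 'rV[R]_3 -> 'I_3 -> 'I_3 -> 'I_3 -> 'I_3 -> R) : Prop :=
  forall i X, smooth_vector i X -> forall x a b c, cod i x ->
    nabla_endo N i (nabla_vect N i X) x a b c
    - nabla_endo N i (nabla_vect N i X) x b a c =
    \sum_d Rm i x a b c d * X x d.

(* W i x a b c d is W_{ab}^c_d. *)
Definition is_projective_weyl (N : connection)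
    (W : chart M -> 'rV[R]_3 -> 'I_3 -> 'I_3 -> 'I_3 -> 'I_3 -> R) : Prop :=
  exists Rm, exists P : chart M -> 'rV[R]_3 -> 'I_3 -> 'I_3 -> R,
    is_curvature N Rm /\
    forall i x, cod i x ->
      let beta a b := - 2 * ((P i x a b - P i x b a) / 2) in
      [/\ forall a b c d,
            Rm i x a b c d =
            W i x a b c d + kron a c * P i x b d - kron b c * P i x a d
            + beta a b * kron d c,
          forall b d, \sum_a W i x a b a d = 0,
          forall a d, \sum_b W i x a b b d = 0 &
          forall a b, \sum_c W i x a b c c = 0].

(* V^{ab}_c = eps^{dea} W_{de}^b_c *)
Definition Vtensor (eps : volume_trivector)
    (W : chart M -> 'rV[R]_3 -> 'I_3 -> 'I_3 -> 'I_3 -> 'I_3 -> R)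
    (i : chart M) (x : 'rV[R]_3) (a b c : 'I_3) : R :=
  \sum_d \sum_e eps i x d e a * W i x d e b c.

End Tensors.

Section Obstruction.
Variable R : realType.

(* Contravariant tensors of rank k at a point, by components; the argument
   is the k-tuple of indices. *)
Definition tensor (k : nat) := ('I_k -> 'I_3) -> R.

Definition symmetrise k (P : tensor k) : tensor k :=
  fun i => (k`!%:R)^-1 * \sum_(s : 'S_k) P (fun m => i (s m)).

Definition odot j k (P : tensor j) (Q : tensor k) : tensor (j + k) :=
  symmetrise (fun i : 'I_(j + k) -> 'I_3 =>
    P (fun m => i (lshift k m)) * Q (fun m => i (rshift j m))).

(* V a b c is V^{ab}_c; the tuple (i 0, i 1, ...) is the index list (a, b, ...)
   of the free indices, and p, q, r, s, t, u are contracted. *)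
Variable V : 'I_3 -> 'I_3 -> 'I_3 -> R.

Definition tA : tensor 2 := symmetrise (fun i : 'I_2 -> 'I_3 =>
  \sum_p \sum_q V (i 0) p q * V (i 1) q p).

Definition tB : tensor 3 := symmetrise (fun i : 'I_3 -> 'I_3 =>
  \sum_p \sum_q \sum_r V (i 0) p q * V (i 1) q r * V (i 2) r p).

Definition tC : tensor 3 := symmetrise (fun i : 'I_3 -> 'I_3 =>
  \sum_p \sum_q \sum_r V (i 0) (i 1) p * V p q r * V (i 2) r q).

Definition tD : tensor 4 := symmetrise (fun i : 'I_4 -> 'I_3 =>
  \sum_p \sum_q \sum_r \sum_s
    V (i 0) (i 1) p * V p q r * V (i 2) r s * V (i 3) s q).

Definition tF : tensor 4 := symmetrise (fun i : 'I_4 -> 'I_3 =>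
  \sum_p \sum_q \sum_r \sum_s
    V (i 0) (i 1) p * V (i 2) (i 3) q * V p r s * V q s r).

Definition tJ : tensor 6 := symmetrise (fun i : 'I_6 -> 'I_3 =>
  \sum_p \sum_q \sum_r \sum_s \sum_t \sum_u
    V (i 0) (i 1) p * V (i 2) (i 3) q * V p q r
    * V (i 4) r s * V s t u * V (i 5) u t).

Definition tK : tensor 6 := symmetrise (fun i : 'I_6 -> 'I_3 =>
  \sum_p \sum_q \sum_r \sum_s \sum_t \sum_u
    V (i 0) (i 1) p * V (i 2) (i 3) q * V (i 4) p r
    * V (i 5) q s * V r t u * V s u t).

Definition tL : tensor 6 := symmetrise (fun i : 'I_6 -> 'I_3 =>
  \sum_p \sum_q \sum_r \sum_s \sum_t \sum_u
    V (i 0) (i 1) p * V (i 2) (i 3) q * V p q r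
    * V r s t * V (i 4) t u * V (i 5) u s).

Definition tT : tensor 6 := fun i =>
  24 * tJ i + 12 * tK i - 24 * tL i
  - 24 * odot tB tB i - 24 * odot tC tC i + 40 * odot tB tC i
  - 24 * odot tA tD i + 6 * odot tA tF i.

End Obstruction.

(* Main.v *)
Require Import Defs.
From HB Require Import structures.
From mathcomp Require Import all_boot all_order all_algebra all_fingroup.
From mathcomp Require Import all_classical all_reals all_analysis.
From mathcomp Require Import ring lra.

Set Implicit Arguments.
Unset Strict Implicit.
Unset Printing Implicit Defensive.

Import Order.TTheory GRing.Theory Num.Theory.
Import numFieldNormedType.Exports.

Local Open Scope classical_set_scope.
Local Open Scope ring_scope.

(** At a point, V is the dual of the Weyl tensor, and T is a polynomial in V,
so everything rests on the shape of V for a metric connection.  A projective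
change leaves the Weyl tensor alone ([curvature_projective]), so one may use
the Levi-Civita connection of g.  In dimension three its lowered curvature is
skew in both pairs of indices, hence of the form eta_abe eta_cdf E^ef, with E
symmetric by the Bianchi identity; dualising one pair and raising an index with G = g^-1 gives
(up to the scale of epsilon)
V^ab_c = eta_cfh (G^ha E^fb + G^hb E^fa), all other terms being forced to
vanish by the symmetry and trace-freeness of V ([dual_weyl_pencil]).  The skew
symmetry of the lowered curvature in its last pair is where second derivatives
of g have to commute, whence [derive_comm].

It remains to see that T vanishes on every V built in this way from two
symmetric tensors G, H.  A symmetric tensor is determined by its values
T(xi) = T^abcdef xi_a ... xi_f ([polarisation]).  With M_z the matrix
V^ab_c z_a, and v = xi M_xi, u = v M_xi, w = v M_v, the contractions A, ..., L
become traces of products of M_xi, M_v, M_u, M_w and M_(w M_xi)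
([evaluate_tT]).  For a pencil V one has, with lambda a scalar,
w = lambda xi, B = 3 lambda / 4, C = 3 lambda / 2, D = F / 2 and
24 K = 9 lambda^2 + 12 A F, while w = lambda xi makes J = lambda C and
L = lambda B.  Substituting these in T(xi), the terms in lambda^2 and those
in A F cancel separately.  The identities are equivariant under GL(3), which
acts transitively on nonzero covectors, so they are checked at the first
coordinate covector ([pencil_obstruction_at]).

For the nonvanishing part, a connection on R^3 with linear Christoffel symbols
is chosen so that at the origin M_xi is diagonal for xi the first coordinate
covector; T(xi) is then a nonzero number. *)

(** * Index calculus in dimension three *)

Definition o0 : 'I_3 := @Ordinal 3 0 isT.
Definition o1 : 'I_3 := @Ordinal 3 1 isT.
Definition o2 : 'I_3 := @Ordinal 3 2 isT.

Lemma ord3_ind (P : 'I_3 -> Prop) : P o0 -> P o1 -> P o2 -> forall i, P i.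
Proof.
move=> P0 P1 P2 [[|[|[|//]]] Hi].
- by rewrite (_ : Ordinal Hi = o0) //; apply: val_inj.
- by rewrite (_ : Ordinal Hi = o1) //; apply: val_inj.
- by rewrite (_ : Ordinal Hi = o2) //; apply: val_inj.
Qed.

Lemma sum3 (V : nmodType) (F : 'I_3 -> V) :
  \sum_i F i = F o0 + F o1 + F o2.
Proof.
rewrite !big_ord_recl big_ord0 addr0 addrA.
by congr (F _ + F _ + F _); apply: val_inj.
Qed.

Section Pencil.
Variable R : realType.

(** The Levi-Civita symbol. *)
Definition eta (a b c : 'I_3) : R :=
  match nat_of_ord a, nat_of_ord b, nat_of_ord c with
  | 0, 1, 2 | 1, 2, 0 | 2, 0, 1 => 1
  | 0, 2, 1 | 2, 1, 0 | 1, 0, 2 => -1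
  | _, _, _ => 0
  end.

Lemma sum_kron (F : 'I_3 -> R) b : \sum_e F e * kron R e b = F b.
Proof.
rewrite (bigD1 b) //= big1 => [|e ne]; first by rewrite /kron eqxx mulr1 addr0.
by rewrite /kron (negbTE ne) mulr0.
Qed.

(** * Pencils of symmetric tensors *)

(** The matrix of u |-> eta(., ., u): row f, column c holds eta_cfh u^h, the
order in which it multiplies a tensor H^bf from the right. *)
Definition cross (u : 'cV[R]_3) : 'M[R]_3 :=
  \matrix_(f, c) \sum_h eta c f h * u h 0.

Lemma cross_scale (k : R) u : cross (k *: u) = k *: cross u.
Proof.
apply/matrixP => f c; rewrite !mxE mulr_sumr.
by apply: eq_bigr => h _; rewrite !mxE mulrCA.
Qed.

Lemma cross_add u v : cross (u + v) = cross u + cross v.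
Proof.
apply/matrixP => f c; rewrite !mxE -big_split.
by apply: eq_bigr => h _; rewrite !mxE mulrDr.
Qed.

Lemma crossE u f c : cross u f c =
  eta c f o0 * u o0 0 + eta c f o1 * u o1 0 + eta c f o2 * u o2 0.
Proof. by rewrite !mxE sum3. Qed.

(** The determinant, expanded so that [ring] can compute with it. *)
Definition det3 (S : 'M[R]_3) : R :=
  S o0 o0 * (S o1 o1 * S o2 o2 - S o1 o2 * S o2 o1)
  - S o0 o1 * (S o1 o0 * S o2 o2 - S o1 o2 * S o2 o0)
  + S o0 o2 * (S o1 o0 * S o2 o1 - S o1 o1 * S o2 o0).

(** The volume form pulled back by S is det S times itself. *)
Lemma cross_covariant (S : 'M[R]_3) u :
  S^T *m cross (S *m u) *m S = det3 S *: cross u.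
Proof.
have Eu h : (S *m u) h 0 = S h o0 * u o0 0 + S h o1 * u o1 0 + S h o2 * u o2 0.
  by rewrite mxE sum3.
have E (A : 'M[R]_3) i j : (S^T *m A *m S) i j =
   (S o0 i * A o0 o0 + S o1 i * A o1 o0 + S o2 i * A o2 o0) * S o0 j
   + (S o0 i * A o0 o1 + S o1 i * A o1 o1 + S o2 i * A o2 o1) * S o1 j
   + (S o0 i * A o0 o2 + S o1 i * A o1 o2 + S o2 i * A o2 o2) * S o2 j.
  by rewrite mxE sum3 !mxE !sum3 !mxE.
apply/matrixP => i j; rewrite E [RHS]mxE !crossE !Eu /det3.
elim/ord3_ind: i; elim/ord3_ind: j; rewrite /eta /=.
all: ring.
Qed.

(** Read off from [cross_covariant]: if det S were 0, then [cross] would vanish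
identically, S being invertible. *)
Lemma det3_neq0 (S : 'M[R]_3) : S \in unitmx -> det3 S != 0.
Proof.
move=> uS; apply/eqP => d0.
pose u : 'cV[R]_3 := delta_mx o0 0.
have cross0 : cross u = 0.
  have := cross_covariant S (invmx S *m u).
  rewrite d0 scale0r mulKVmx // => E0.
  have uT : S^T \in unitmx by rewrite unitmx_tr.
  by rewrite -[LHS](mulKmx uT) -[LHS](mulmxK uS) -(mulmxA _ _ S) E0 mulmx0 mul0mx.
have := crossE u o2 o1; rewrite cross0 !mxE /eta /= => /eqP.
by rewrite !mulr0 !addr0 !mulr1 eq_sym oner_eq0.
Qed.

(** M_xi, with entries V^ab_c xi_a in row b and column c. *)
Definition contraction (V : 'I_3 -> 'I_3 -> 'I_3 -> R) (xi : 'rV[R]_3) : 'M[R]_3 :=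
  \matrix_(b, c) \sum_a xi 0 a * V a b c.

(** T(xi) as a function of the linear family M of matrices. The traces are, in
order, those of J, K, L, B, C, B and C, A and D, A and F; see [evaluate_tT]. *)
Definition obstruction_form (M : 'rV[R]_3 -> 'M[R]_3) (xi : 'rV[R]_3) : R :=
  let m := M xi in let v := xi *m m in let w := v *m M v in let u := v *m m in
  24 * \tr (M (w *m m) *m m) + 12 * \tr (M u *m M u)
  - 24 * \tr (M w *m m *m m) - 24 * \tr (m *m m *m m) ^+ 2
  - 24 * \tr (M v *m m) ^+ 2 + 40 * (\tr (m *m m *m m) * \tr (M v *m m))
  - 24 * (\tr (m *m m) * \tr (M v *m m *m m))
  + 6 * (\tr (m *m m) * \tr (M v *m M v)).

Lemma obstruction_form_covariant (M M' : 'rV[R]_3 -> 'M[R]_3) (S : 'M[R]_3) xi :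
  S \in unitmx -> (forall z, M' z = S *m M (z *m S) *m invmx S) ->
  obstruction_form M' xi = obstruction_form M (xi *m S).
Proof.
move=> uS M'E.
have conjM A B : (S *m A *m invmx S) *m (S *m B *m invmx S) =
    S *m (A *m B) *m invmx S by rewrite !mulmxA mulmxKV.
have trC A : \tr (S *m A *m invmx S) = \tr A.
  by rewrite mxtrace_mulC mulmxA mulVmx // mul1mx.
have vecM z A : z *m invmx S *m (S *m A *m invmx S) = z *m A *m invmx S.
  by rewrite !mulmxA mulmxKV.
have M'v z : M' (z *m invmx S) = S *m M z *m invmx S by rewrite M'E mulmxKV.
rewrite /obstruction_form -[in LHS](mulmxK uS xi).
by rewrite !(M'v, vecM, conjM, trC).
Qed.

(** The matrix M_xi of V^ab_c = eta_cfh (G^ha H^fb + G^hb H^fa), written so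
that its behaviour under a change of basis is visible. It is skew in (G, H),
so it depends on the pencil spanned by G and H only, up to scale. *)
Definition pencil_mx (G H : 'M[R]_3) (xi : 'rV[R]_3) : 'M[R]_3 :=
  H *m cross (G *m xi^T) - G *m cross (H *m xi^T).

(** The determinant coming from the volume form is absorbed in the first
tensor of the pencil, so that the class of pencils is stable under change of
basis. *)
Lemma pencil_mx_covariant (G H S : 'M[R]_3) : S \in unitmx ->
  forall z, pencil_mx ((det3 S)^-1 *: (S *m G *m S^T)) (S *m H *m S^T) z =
    S *m pencil_mx G H (z *m S) *m invmx S.
Proof.
move=> uS z; have d0 := det3_neq0 uS.
have uT : S^T \in unitmx by rewrite unitmx_tr.
have K u : S^T *m cross (S *m u) = det3 S *: (cross u *m invmx S).
  by rewrite -[LHS](mulmxK uS) cross_covariant -scalemxAl.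
have X A B : S *m A *m S^T *m cross (S *m B *m S^T *m z^T) =
    det3 S *: (S *m (A *m cross (B *m (z *m S)^T)) *m invmx S).
  by rewrite trmx_mul -!mulmxA K -!scalemxAr !mulmxA.
rewrite /pencil_mx -!scalemxAl cross_scale -!scalemxAr !X !scalerA.
by rewrite mulVf // !scale1r mulmxBr mulmxBl.
Qed.

Lemma pencil_mxE (G H : 'M[R]_3) (xi : 'rV[R]_3) : G^T = G -> H^T = H ->
  let x := xi 0 o0 in let y := xi 0 o1 in let z := xi 0 o2 in
  let g i := G i o0 * x + G i o1 * y + G i o2 * z in
  let h i := H i o0 * x + H i o1 * y + H i o2 * z in
  forall b : 'I_3, [/\
    pencil_mx G H xi b o0 =
      H b o1 * g o2 - H b o2 * g o1 - (G b o1 * h o2 - G b o2 * h o1),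
    pencil_mx G H xi b o1 =
      H b o2 * g o0 - H b o0 * g o2 - (G b o2 * h o0 - G b o0 * h o2) &
    pencil_mx G H xi b o2 =
      H b o0 * g o1 - H b o1 * g o0 - (G b o0 * h o1 - G b o1 * h o0)].
Proof.
move=> symG symH x y z g h b.
have E A i : (A *m xi^T) i 0 = A i o0 * x + A i o1 * y + A i o2 * z.
  by rewrite mxE sum3 !mxE.
have K A B i : (A *m cross B : 'M[R]_3) b i =
   A b o0 * cross B o0 i + A b o1 * cross B o1 i + A b o2 * cross B o2 i.
  by rewrite mxE sum3.
rewrite /pencil_mx 3![(_ - _ : 'M[R]_3) b _]mxE.
rewrite 3![(- _ : 'M[R]_3) b _]mxE !K !crossE !E -!/(g _) -!/(h _) /eta /=.
by split; ring.
Qed.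

Lemma trace_mul3 (A B : 'M[R]_3) : \tr (A *m B) =
  A o0 o0 * B o0 o0 + A o0 o1 * B o1 o0 + A o0 o2 * B o2 o0 +
  (A o1 o0 * B o0 o1 + A o1 o1 * B o1 o1 + A o1 o2 * B o2 o1) +
  (A o2 o0 * B o0 o2 + A o2 o1 * B o1 o2 + A o2 o2 * B o2 o2).
Proof. by rewrite /mxtrace sum3 !mxE !sum3. Qed.

Lemma mul_row3 (u : 'rV[R]_3) (A : 'M[R]_3) i : (u *m A) 0 i =
  u 0 o0 * A o0 i + u 0 o1 * A o1 i + u 0 o2 * A o2 i.
Proof. by rewrite mxE sum3. Qed.

Lemma mul_mx3 (A B : 'M[R]_3) i j : (A *m B) i j =
  A i o0 * B o0 j + A i o1 * B o1 j + A i o2 * B o2 j.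
Proof. by rewrite mxE sum3. Qed.

(** The covector is now e, the first of the basis. The quantities derived from
it are variables constrained by equations rather than local definitions, so
that rewriting does not unfold them. *)
Section AtFirstCovector.
Variables G H : 'M[R]_3.
Hypotheses (symG : G^T = G) (symH : H^T = H).
Variables (M : 'rV[R]_3 -> 'M[R]_3) (e e1 e2 v w u : 'rV[R]_3) (m : 'M[R]_3).
Variable lambda : R.
Hypotheses (Mdef : M = pencil_mx G H) (mdef : m = M e).
Hypotheses (edef : e = delta_mx 0 o0) (e1def : e1 = delta_mx 0 o1).
Hypotheses (e2def : e2 = delta_mx 0 o2).
Hypotheses (vdef : v = e *m m) (wdef : w = v *m M v) (udef : u = v *m m).
Hypothesis lambdadef : lambda = w 0 o0.

Let G10 : G o1 o0 = G o0 o1. Proof. by rewrite -[in LHS]symG mxE. Qed.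
Let G20 : G o2 o0 = G o0 o2. Proof. by rewrite -[in LHS]symG mxE. Qed.
Let G21 : G o2 o1 = G o1 o2. Proof. by rewrite -[in LHS]symG mxE. Qed.
Let H10 : H o1 o0 = H o0 o1. Proof. by rewrite -[in LHS]symH mxE. Qed.
Let H20 : H o2 o0 = H o0 o2. Proof. by rewrite -[in LHS]symH mxE. Qed.
Let H21 : H o2 o1 = H o1 o2. Proof. by rewrite -[in LHS]symH mxE. Qed.
Let sE := (G10, G20, G21, H10, H20, H21).

Let ME (z : 'rV[R]_3) :
  let x := z 0 o0 in let y := z 0 o1 in let t := z 0 o2 in
  let g i := G i o0 * x + G i o1 * y + G i o2 * t in
  let h i := H i o0 * x + H i o1 * y + H i o2 * t in
  forall b : 'I_3, [/\
    M z b o0 = H b o1 * g o2 - H b o2 * g o1 - (G b o1 * h o2 - G b o2 * h o1),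
    M z b o1 = H b o2 * g o0 - H b o0 * g o2 - (G b o2 * h o0 - G b o0 * h o2) &
    M z b o2 = H b o0 * g o1 - H b o1 * g o0 - (G b o0 * h o1 - G b o1 * h o0)].
Proof. by rewrite Mdef; apply: pencil_mxE. Qed.

Let M0 z b := let: And3 E _ _ := ME z b in E.
Let M1 z b := let: And3 _ E _ := ME z b in E.
Let M2 z b := let: And3 _ _ E := ME z b in E.

Let mE b : [/\
  m b o0 = H b o1 * G o0 o2 - H b o2 * G o0 o1
           - (G b o1 * H o0 o2 - G b o2 * H o0 o1),
  m b o1 = H b o2 * G o0 o0 - H b o0 * G o0 o2
           - (G b o2 * H o0 o0 - G b o0 * H o0 o2) &
  m b o2 = H b o0 * G o0 o1 - H b o1 * G o0 o0
           - (G b o0 * H o0 o1 - G b o1 * H o0 o0)].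
Proof.
have [] := ME e b; rewrite -mdef => -> -> ->.
by rewrite edef !mxE /= !sE; split; ring.
Qed.

Let m0 b := let: And3 E _ _ := mE b in E.
Let m1 b := let: And3 _ E _ := mE b in E.
Let m2 b := let: And3 _ _ E := mE b in E.
Let mEs := (m0, m1, m2).

Let vE i : v 0 i = m o0 i.
Proof. by rewrite vdef edef -rowE mxE. Qed.

Let MvE := (M0 v, M1 v, M2 v).

(** The covector v is a multiple of Ge x He, so e annihilates Gv and Hv; as w
is in turn a multiple of Gv x Hv, it is a multiple of e. *)
Let w_colinear : w = lambda *: e.
Proof.
apply/rowP => i; rewrite [RHS]mxE lambdadef edef.
elim/ord3_ind: i; rewrite [delta_mx _ _ _ _]mxE /= ?mulr1 ?mulr0 //.
all: rewrite wdef mul_row3 !MvE !vE !mEs !sE; ring.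
Qed.

Let lambdaE : lambda = m o0 o0 * M v o0 o0 + m o0 o1 * M v o1 o0
  + m o0 o2 * M v o2 o0.
Proof. by rewrite lambdadef wdef mul_row3 !vE. Qed.

Let traceB : 4 * \tr (m *m m *m m) = 3 * lambda.
Proof.
rewrite lambdaE trace_mul3 !mul_mx3 !MvE !vE !mEs !sE; ring.
Qed.

Let traceC : 2 * \tr (M v *m m) = 3 * lambda.
Proof.
rewrite lambdaE trace_mul3 !MvE !vE !mEs !sE; ring.
Qed.

Let traceD : 2 * \tr (M v *m m *m m) = \tr (M v *m M v).
Proof.
rewrite !trace_mul3 !mul_mx3 !MvE !vE !mEs !sE; ring.
Qed.

Let M_scale (k : R) (z : 'rV[R]_3) : M (k *: z) = k *: M z.
Proof.
rewrite Mdef /pencil_mx linearZ /= -!scalemxAr !cross_scale -!scalemxAr.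
by rewrite -scalerBr.
Qed.

Let M_add (y z : 'rV[R]_3) : M (y + z) = M y + M z.
Proof.
rewrite Mdef /pencil_mx linearD /= !mulmxDr !cross_add !mulmxDr.
by rewrite opprD addrACA.
Qed.

(* Expanding tr(M_u M_u) and tr(M_v M_v) through the six products of basis
   matrices keeps the polynomials in the next identity small. *)
Let q (x y : 'rV[R]_3) : R := \tr (M x *m M y).

Let q_quad z : q z z =
  z 0 o0 ^+ 2 * q e e + z 0 o1 ^+ 2 * q e1 e1 + z 0 o2 ^+ 2 * q e2 e2
  + 2 * (z 0 o0 * z 0 o1 * q e e1 + z 0 o0 * z 0 o2 * q e e2
         + z 0 o1 * z 0 o2 * q e1 e2).
Proof.
have zE : z = z 0 o0 *: e + z 0 o1 *: e1 + z 0 o2 *: e2.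
  rewrite edef e1def e2def; apply/rowP => i; rewrite !mxE.
  by elim/ord3_ind: i; rewrite /= ?mulr1 ?mulr0 ?addr0 ?add0r.
have qC x y : q x y = q y x by rewrite /q mxtrace_mulC.
rewrite [in LHS]zE /q !M_add !M_scale !(mulmxDl, mulmxDr) -!(scalemxAl, scalemxAr).
rewrite !raddfD /= !linearZ /= -!/(q _ _) (qC e1 e) (qC e2 e) (qC e2 e1).
ring.
Qed.

(** When e, v, u are independent this is a consequence of the preceding
identities: e M_v = u, v M_v = lambda e, and the Cayley-Hamilton theorem gives
u M_e = (A / 2) v + (B / 3) e; since M_e, M_v and M_u are trace-free, this and
the values of C and D give all the entries that tr(M_u M_u) involves in the
basis e, v, u. The computation covers dependent e, v, u as well. *)
Let traceK : 24 * q u u = 9 * lambda ^+ 2 + 12 * (q e e * q v v).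
Proof.
have uE i : u 0 i = m o0 o0 * m o0 i + m o0 o1 * m o1 i + m o0 o2 * m o2 i.
  by rewrite udef mul_row3 !vE.
rewrite (q_quad u) (q_quad v) lambdaE !uE !MvE !vE.
rewrite /q !trace_mul3 -mdef !(M0 e1, M1 e1, M2 e1, M0 e2, M1 e2, M2 e2).
rewrite e1def e2def ![delta_mx _ _ _ _]mxE /= !(mulr0, mulr1, addr0, add0r).
rewrite !mEs !sE.
ring.
Qed.

Lemma pencil_obstruction_at : obstruction_form M e = 0.
Proof.
rewrite /obstruction_form -mdef -vdef -wdef -udef.
have -> : w *m m = lambda *: v by rewrite w_colinear -scalemxAl -vdef.
rewrite w_colinear !M_scale -mdef -!scalemxAl !mxtraceZ.
have -> : 12 * \tr (M u *m M u) = 24 * q u u / 2 by rewrite /q; field.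
rewrite traceK /q -mdef -traceD.
have -> : \tr (m *m m *m m) = 3 / 4 * lambda.
  by have := traceB; lra.
have -> : \tr (M v *m m) = 3 / 2 * lambda.
  by have := traceC; lra.
by field.
Qed.

End AtFirstCovector.

(** Every nonzero covector is the image of the first one under some S in GL(3),
and [obstruction_form] is equivariant. *)
Lemma pencil_obstruction (G H : 'M[R]_3) xi : G^T = G -> H^T = H ->
  obstruction_form (pencil_mx G H) xi = 0.
Proof.
move=> symG symH.
pose e : 'rV[R]_3 := delta_mx 0 o0.
have [-> | xi0] := eqVneq xi 0.
  rewrite /obstruction_form !mul0mx /pencil_mx trmx0 !mulmx0.
  have -> : cross 0 = 0 by rewrite -(scale0r 0) cross_scale scale0r.
  by rewrite !(mulmx0, subrr, mul0mx, mxtrace0, mulr0, expr0n, addr0).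
have [S uS eS] : exists2 S : 'M[R]_3, S \in unitmx & e *m S = xi.
  pose f : 'M[R]_3 := \matrix_(i, j) xi 0 j.
  have ef : e *m f = xi by rewrite -rowE; apply/rowP => j; rewrite !mxE.
  have [|S uS E] := @complete_unitmx _ _ _ e f; last by exists S; rewrite -?E.
  by rewrite ef !rank_rV xi0 (_ : e != 0) //; apply/eqP => /rowP /(_ o0);
    rewrite !mxE eqxx /=; apply/eqP; rewrite oner_eq0.
rewrite -eS -(obstruction_form_covariant _ uS (pencil_mx_covariant G H uS)).
apply: (pencil_obstruction_at _ _ erefl erefl erefl erefl erefl erefl erefl erefl erefl).
  by rewrite linearZ /= !trmx_mul trmxK symG mulmxA.
by rewrite !trmx_mul trmxK symH mulmxA.
Qed.

End Pencil.

(** * Evaluation of symmetric tensors on covectors *)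

Section Polarisation.
Variable R : realType.

(** P^{a...b} xi_a ... xi_b. *)
Definition evaluate k (P : tensor R k) (xi : 'rV[R]_3) : R :=
  \sum_(f : {ffun 'I_k -> 'I_3}) P f * \prod_m xi 0 (f m).

Lemma prod_natb (I : finType) (c : pred I) :
  \prod_i (c i)%:R = [forall i, c i]%:R :> R.
Proof.
case: (boolP [forall i, c i]) => [/forallP call | /forallPn [i ci]].
  by rewrite big1 // => i _; rewrite call.
by rewrite (bigD1 i) //= (negbTE ci) mul0r.
Qed.

(** The usual polarisation formula. For covectors e_1, ..., e_k of the basis
picked by the indices i, the alternating sum over subsets b of the values of P
at the sum of the e_n with n in b keeps only the terms that use each e_n
exactly once, and these are the terms of the symmetrisation. *)
Lemma polarisation k (P : tensor R k) :
  (forall xi, evaluate P xi = 0) -> symmetrise P = fun=> 0.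
Proof.
move=> P0; apply/funext => i; rewrite /symmetrise; apply/eqP.
rewrite mulf_eq0; apply/orP; right; apply/eqP.
pose xi (b : {ffun 'I_k -> bool}) : 'rV[R]_3 :=
  \row_a \sum_n (b n && (i n == a))%:R.
have evalE b : evaluate P (xi b) =
    \sum_(h : {ffun 'I_k -> 'I_k}) [forall m, b (h m)]%:R * P (fun m => i (h m)).
  rewrite /evaluate.
  transitivity (\sum_(f : {ffun 'I_k -> 'I_3}) \sum_(h : {ffun 'I_k -> 'I_k})
      P f * [forall m, b (h m) && (i (h m) == f m)]%:R).
    apply: eq_bigr => f _; rewrite -mulr_sumr; congr (_ * _).
    transitivity (\prod_m \sum_n (b n && (i n == f m))%:R : R).
      by apply: eq_bigr => m _; rewrite mxE.
    by rewrite bigA_distr_bigA; apply: eq_bigr => h _; rewrite prod_natb.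
  rewrite exchange_big; apply: eq_bigr => h _ /=.
  pose f0 := [ffun m => i (h m)].
  have -> : (fun m => i (h m)) = f0 by apply/funext => m; rewrite ffunE.
  rewrite (bigD1 f0) //= big1 ?addr0 => [|f neq_f].
    rewrite mulrC; congr (_%:R * _); congr (nat_of_bool _).
    by apply: eq_forallb => m; rewrite ffunE eqxx andbT.
  have -> : [forall m, b (h m) && (i (h m) == f m)] = false; last by rewrite mulr0.
  apply: contraNF neq_f => /forallP E; apply/eqP/ffunP => m.
  by rewrite ffunE; have /andP[_ /eqP ->] := E m.
(* Inclusion-exclusion over the subsets b that contain the image of h. *)
have sgn (h : {ffun 'I_k -> 'I_k}) :
    \sum_(b : {ffun 'I_k -> bool})
      (\prod_n (if b n then 1 else -1)) * [forall m, b (h m)]%:R =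
    (injectiveb h)%:R :> R.
  transitivity (\sum_(b : {ffun 'I_k -> bool})
      \prod_n (if b n then 1 else - (n \notin codom h)%:R) : R).
    apply: eq_bigr => b _.
    have -> : [forall m, b (h m)] = [forall n, b n || (n \notin codom h)].
      apply/forallP/forallP => [bh n | bh m]; last first.
        by have := bh (h m); rewrite codom_f orbF.
      by rewrite orbC; case: codomP => //= -[m ->]; rewrite bh.
    rewrite -prod_natb -big_split /=; apply: eq_bigr => n _.
    by case: (b n); rewrite /= ?mul1r ?mulN1r.
  rewrite -(bigA_distr_bigA (fun n c => if c then 1 else - (n \notin codom h)%:R)).
  transitivity (\prod_n (n \in codom h)%:R : R).
    apply: eq_bigr => n _; rewrite big_bool /=.
    by case: (n \in codom h); rewrite /= ?subr0 ?subrr.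
  rewrite prod_natb; congr (nat_of_bool _)%:R.
  apply/forallP/injectiveP => [surj | inj n]; last first.
    by rewrite (injF_onto inj).
  apply/injectiveP; rewrite /injectiveb /dinjectiveb.
  apply: (leq_size_uniq (enum_uniq 'I_k)) => [n _ |]; first exact: surj.
  by rewrite size_map.
have: \sum_(b : {ffun 'I_k -> bool})
    (\prod_n (if b n then 1 else -1)) * evaluate P (xi b) = 0.
  by rewrite big1 // => b _; rewrite P0 mulr0.
under eq_bigr do rewrite evalE mulr_sumr.
rewrite exchange_big /=.
under eq_bigr do (under eq_bigr do rewrite mulrA; rewrite -mulr_suml sgn).
rewrite (bigID (fun h : {ffun _ -> _} => injectiveb h)) /= addrC big1 ?add0r; last first.
  by move=> h /negbTE ->; rewrite mul0r.
under eq_bigr => h -> do rewrite mul1r.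
rewrite (reindex (@pval _)) /=; last first.
  pose in_Sn := insubd (1%g : 'S_k).
  by exists in_Sn => /= f Uf; first apply: val_inj; apply: insubdK.
move=> E; rewrite -[RHS]E; apply: eq_big => [s | s _].
  by rewrite (valP s).
by congr P; apply/funext => m; rewrite pvalE.
Qed.

Lemma evaluate_sum k (I : finType) (F : I -> tensor R k) xi :
  evaluate (fun i => \sum_p F p i) xi = \sum_p evaluate (F p) xi.
Proof.
rewrite /evaluate exchange_big; apply: eq_bigr => f _ /=.
by rewrite mulr_suml.
Qed.

Lemma evaluate_scale k c (P : tensor R k) xi :
  evaluate (fun i => c * P i) xi = c * evaluate P xi.
Proof.
by rewrite /evaluate mulr_sumr; apply: eq_bigr => f _ /=; rewrite mulrA.
Qed.

(** A product of copies of xi is already symmetric. *)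
Lemma evaluate_symmetrise k (P : tensor R k) xi :
  evaluate (symmetrise P) xi = evaluate P xi.
Proof.
rewrite /symmetrise evaluate_scale.
have -> : evaluate (fun i => \sum_(s : 'S_k) P (fun m => i (s m))) xi =
    \sum_(s : 'S_k) evaluate P xi.
  rewrite evaluate_sum; apply: eq_bigr => s _; rewrite /evaluate.
  rewrite [RHS](reindex_inj (h := fun f : {ffun 'I_k -> 'I_3} => [ffun m => f (s m)])).
    apply: eq_bigr => f _; congr (P _ * _).
      by apply/funext => m; rewrite ffunE.
    rewrite (reindex_inj (@perm_inj _ s)).
    by apply: eq_bigr => m _; rewrite ffunE.
  move=> f g /ffunP E; apply/ffunP => m.
  by have := E (s^-1 m)%g; rewrite !ffunE permKV.
rewrite sumr_const card_Sn -[X in _ * X]mulr_natl mulrA mulVf ?mul1r //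
  pnatr_eq0 -lt0n fact_gt0.
Qed.

Definition glue j k (g : {ffun 'I_j -> 'I_3}) (h : {ffun 'I_k -> 'I_3}) :
  {ffun 'I_(j + k) -> 'I_3} :=
  [ffun m => match fintype.split m with inl a => g a | inr b => h b end].

Lemma glue_lshift j k g h m : @glue j k g h (lshift k m) = g m.
Proof. by rewrite ffunE (unsplitK (inl m)). Qed.

Lemma glue_rshift j k g h m : @glue j k g h (rshift j m) = h m.
Proof. by rewrite ffunE (unsplitK (inr m)). Qed.

Lemma sum_glue j k (F : {ffun 'I_(j + k) -> 'I_3} -> R) :
  \sum_f F f = \sum_g \sum_h F (glue g h).
Proof.
rewrite pair_bigA /=; apply: reindex.
exists (fun f : {ffun 'I_(j + k) -> 'I_3} =>
  ([ffun m => f (lshift k m)], [ffun m => f (rshift j m)])) => [[g h] | f] _ /=.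
  by congr (_, _); apply/ffunP => m; rewrite ffunE ?glue_lshift ?glue_rshift.
apply/ffunP => m; rewrite ffunE.
by case: (splitP m) => a ma; rewrite ffunE; congr (f _); apply: val_inj.
Qed.

Lemma evaluate_tensor j k (P : tensor R j) (Q : tensor R k) xi :
  evaluate (fun i : 'I_(j + k) -> 'I_3 =>
    P (fun m => i (lshift k m)) * Q (fun m => i (rshift j m))) xi =
  evaluate P xi * evaluate Q xi.
Proof.
rewrite /evaluate sum_glue big_distrlr /=.
apply: eq_bigr => g _; apply: eq_bigr => h _.
rewrite big_split_ord /=.
rewrite (_ : (fun m => glue g h (lshift k m)) = g); last first.
  by apply/funext => m; rewrite glue_lshift.
rewrite (_ : (fun m => glue g h (rshift j m)) = h); last first.
  by apply/funext => m; rewrite glue_rshift.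
under eq_bigr do rewrite glue_lshift.
under [X in _ * _ * (_ * X)]eq_bigr do rewrite glue_rshift.
by rewrite mulrACA.
Qed.

Lemma evaluate_odot j k (P : tensor R j) (Q : tensor R k) xi :
  evaluate (odot P Q) xi = evaluate P xi * evaluate Q xi.
Proof. by rewrite evaluate_symmetrise evaluate_tensor. Qed.

Lemma sum_ffun1 (F : {ffun 'I_1 -> 'I_3} -> R) :
  \sum_f F f = \sum_a F [ffun=> a].
Proof.
apply: reindex; exists (fun f : {ffun 'I_1 -> 'I_3} => f ord0) => [a | f] _.
  by rewrite ffunE.
by apply/ffunP => m; rewrite ffunE (ord1 m).
Qed.

Lemma evaluate1 (h : 'I_3 -> R) xi :
  evaluate (fun i : 'I_1 -> 'I_3 => h (i 0)) xi = \sum_a xi 0 a * h a.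
Proof.
rewrite /evaluate sum_ffun1; apply: eq_bigr => a _.
by rewrite big_ord1 !ffunE mulrC.
Qed.

Lemma evaluate2 (h : 'I_3 -> 'I_3 -> R) xi :
  evaluate (fun i : 'I_2 -> 'I_3 => h (i 0) (i 1)) xi =
  \sum_b xi 0 b * \sum_a xi 0 a * h a b.
Proof.
rewrite /evaluate (@sum_glue 1 1) sum_ffun1.
under eq_bigr do rewrite sum_ffun1.
rewrite exchange_big /=.
apply: eq_bigr => b _; rewrite mulr_sumr; apply: eq_bigr => a _.
have g0 (x : 'I_2) : x = 0%N :> nat -> @glue 1 1 [ffun=> a] [ffun=> b] x = a.
  move=> x0; rewrite ffunE; case: splitP => y yx; rewrite ffunE //.
  by move: yx; rewrite x0 add1n.
have g1 (x : 'I_2) : x = 1%N :> nat -> @glue 1 1 [ffun=> a] [ffun=> b] x = b.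
  move=> x1; rewrite ffunE; case: splitP => y yx; rewrite ffunE //.
  by have := ltn_ord y; rewrite -yx x1.
by rewrite big_ord_recl big_ord1 (g0 0) ?(g0 ord0) ?(g1 1) ?(g1 (lift ord0 ord0)) //; ring.
Qed.

Lemma evaluate_frame k (P : tensor R k) (a : 'I_3) :
  evaluate P (delta_mx 0 a) = P (fun=> a).
Proof.
rewrite /evaluate (bigD1 [ffun=> a]) //= [X in _ + X]big1 ?addr0 => [|f ne].
  rewrite big1 ?mulr1; last first.
    by move=> m _; rewrite mxE ffunE !eqxx.
  by congr P; apply/funext => m; rewrite ffunE.
have [m fm] : exists m, f m != a.
  apply/existsP; apply: contraR ne => /existsPn E; apply/eqP/ffunP => m.
  by rewrite ffunE; apply/eqP; have := E m; rewrite negbK.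
by rewrite (bigD1 m) //= mxE (negbTE fm) andbF mul0r mulr0.
Qed.

End Polarisation.

(** The contractions A, ..., L are sums over the contracted indices of products
whose free indices sit on one or two at a time of the factors; the names of the
following lemmas list the sizes of these groups. *)
Section Components.
Variable R : realType.
Implicit Types (f g : 'I_3 -> 'I_3 -> R) (h l : 'I_3 -> R) (xi : 'rV[R]_3).

Lemma evaluate11 h l xi :
  evaluate (fun i : 'I_2 -> 'I_3 => h (i 0) * l (i 1)) xi =
  (\sum_a xi 0 a * h a) * \sum_a xi 0 a * l a.
Proof.
rewrite -!evaluate1 -evaluate_tensor; congr evaluate; apply/funext => i.
by congr (h (i _) * l (i _)); apply: val_inj.
Qed.

Lemma evaluate111 h l k xi :
  evaluate (fun i : 'I_3 -> 'I_3 => h (i 0) * l (i 1) * k (i 2)) xi =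
  (\sum_a xi 0 a * h a) * (\sum_a xi 0 a * l a) * \sum_a xi 0 a * k a.
Proof.
rewrite -evaluate11 -evaluate1 -evaluate_tensor.
congr evaluate; apply/funext => i.
by congr (h (i _) * l (i _) * k (i _)); apply: val_inj.
Qed.

Lemma evaluate21 f h xi :
  evaluate (fun i : 'I_3 -> 'I_3 => f (i 0) (i 1) * h (i 2)) xi =
  (\sum_b xi 0 b * \sum_a xi 0 a * f a b) * \sum_a xi 0 a * h a.
Proof.
rewrite -evaluate2 -evaluate1 -evaluate_tensor.
congr evaluate; apply/funext => i.
by congr (f (i _) (i _) * h (i _)); apply: val_inj.
Qed.

Lemma evaluate22 f g xi :
  evaluate (fun i : 'I_4 -> 'I_3 => f (i 0) (i 1) * g (i 2) (i 3)) xi =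
  (\sum_b xi 0 b * \sum_a xi 0 a * f a b) *
  (\sum_b xi 0 b * \sum_a xi 0 a * g a b).
Proof.
rewrite -!evaluate2 -evaluate_tensor.
congr evaluate; apply/funext => i.
by congr (f (i _) (i _) * g (i _) (i _)); apply: val_inj.
Qed.

Lemma evaluate211 f h l xi :
  evaluate (fun i : 'I_4 -> 'I_3 => f (i 0) (i 1) * h (i 2) * l (i 3)) xi =
  (\sum_b xi 0 b * \sum_a xi 0 a * f a b) * (\sum_a xi 0 a * h a) *
  \sum_a xi 0 a * l a.
Proof.
rewrite -evaluate21 -evaluate1 -evaluate_tensor.
congr evaluate; apply/funext => i.
by congr (f (i _) (i _) * h (i _) * l (i _)); apply: val_inj.
Qed.

Lemma evaluate2211 f g h l xi :
  evaluate (fun i : 'I_6 -> 'I_3 =>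
    f (i 0) (i 1) * g (i 2) (i 3) * h (i 4) * l (i 5)) xi =
  (\sum_b xi 0 b * \sum_a xi 0 a * f a b) *
  (\sum_b xi 0 b * \sum_a xi 0 a * g a b) * (\sum_a xi 0 a * h a) *
  \sum_a xi 0 a * l a.
Proof.
rewrite -evaluate22 -!evaluate1 -!evaluate_tensor.
congr evaluate; apply/funext => i.
by congr (f (i _) (i _) * g (i _) (i _) * h (i _) * l (i _)); apply: val_inj.
Qed.

Variables (V : 'I_3 -> 'I_3 -> 'I_3 -> R) (xi : 'rV[R]_3).
Let M := contraction V.
Let m := M xi.
Let v := xi *m m.

Let mE b c : \sum_a xi 0 a * V a b c = m b c.
Proof. by rewrite mxE. Qed.

Let vE p : \sum_b xi 0 b * \sum_a xi 0 a * V a b p = v 0 p.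
Proof. by rewrite mxE; apply: eq_bigr => b _; rewrite mE. Qed.

Let trM z (A : 'M[R]_3) :
  \tr (M z *m A) = \sum_r z 0 r * \sum_s \sum_t V r s t * A t s.
Proof.
rewrite /mxtrace; under eq_bigr do rewrite mxE.
under eq_bigr do under eq_bigr do rewrite mxE mulr_suml.
under eq_bigr do rewrite exchange_big /=.
rewrite exchange_big; apply: eq_bigr => r _ /=.
rewrite mulr_sumr; apply: eq_bigr => s _.
by rewrite mulr_sumr; apply: eq_bigr => t _; rewrite mulrA.
Qed.

Let sum_mul (y : 'rV[R]_3) (A : 'M[R]_3) (c : 'I_3 -> R) :
  \sum_s (y *m A) 0 s * c s = \sum_r y 0 r * \sum_s A r s * c s.
Proof.
under eq_bigr do rewrite mxE mulr_suml.
rewrite exchange_big; apply: eq_bigr => r _ /=.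
by rewrite mulr_sumr; apply: eq_bigr => s _; rewrite mulrA.
Qed.

Let sum_contraction (y z : 'rV[R]_3) (c : 'I_3 -> R) :
  \sum_r (z *m M y) 0 r * c r =
  \sum_p y 0 p * \sum_q z 0 q * \sum_r V p q r * c r.
Proof.
rewrite sum_mul.
under eq_bigr => q _ do under eq_bigr => r _ do rewrite mxE mulr_suml.
under eq_bigr => q _ do rewrite exchange_big mulr_sumr /=.
rewrite exchange_big; apply: eq_bigr => p _ /=; rewrite mulr_sumr.
apply: eq_bigr => q _; rewrite !mulr_sumr; apply: eq_bigr => r _; ring.
Qed.

Lemma evaluate_tA : evaluate (tA V) xi = \tr (m *m m).
Proof.
rewrite evaluate_symmetrise evaluate_sum.
rewrite /mxtrace; apply: eq_bigr => p _; rewrite evaluate_sum mxE.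
by apply: eq_bigr => q _; rewrite (evaluate11 (fun a => V a p q) (fun a => V a q p)) !mE.
Qed.

Lemma evaluate_tB : evaluate (tB V) xi = \tr (m *m m *m m).
Proof.
rewrite evaluate_symmetrise evaluate_sum /mxtrace; apply: eq_bigr => p _.
rewrite evaluate_sum mxE; under [RHS]eq_bigr do rewrite mxE mulr_suml.
rewrite [RHS]exchange_big; apply: eq_bigr => q _ /=; rewrite evaluate_sum.
apply: eq_bigr => r _.
by rewrite (evaluate111 (fun a => V a p q) (fun a => V a q r) (fun a => V a r p)) !mE.
Qed.

Lemma evaluate_tC : evaluate (tC V) xi = \tr (M v *m m).
Proof.
rewrite evaluate_symmetrise evaluate_sum trM; apply: eq_bigr => p _.
rewrite evaluate_sum mulr_sumr; apply: eq_bigr => q _.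
rewrite evaluate_sum mulr_sumr; apply: eq_bigr => r _.
transitivity (V p q r * evaluate (fun i : 'I_3 -> 'I_3 =>
    V (i 0) (i 1) p * V (i 2) r q) xi).
  by rewrite -evaluate_scale; congr evaluate; apply/funext => i; ring.
by rewrite (evaluate21 (fun a b => V a b p) (fun a => V a r q)) vE mE; ring.
Qed.

Lemma evaluate_tD : evaluate (tD V) xi = \tr (M v *m m *m m).
Proof.
rewrite evaluate_symmetrise evaluate_sum -mulmxA trM; apply: eq_bigr => p _.
rewrite evaluate_sum mulr_sumr; apply: eq_bigr => q _.
rewrite evaluate_sum mulr_sumr; apply: eq_bigr => r _.
rewrite evaluate_sum [(m *m m) _ _]mxE !mulr_sumr; apply: eq_bigr => s _.
transitivity (V p q r * evaluate (fun i : 'I_4 -> 'I_3 =>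
    V (i 0) (i 1) p * V (i 2) r s * V (i 3) s q) xi).
  by rewrite -evaluate_scale; congr evaluate; apply/funext => i; ring.
rewrite (evaluate211 (fun a b => V a b p) (fun a => V a r s) (fun a => V a s q)).
by rewrite vE !mE; ring.
Qed.

(* A^pq before symmetrisation. *)
Let killing p q : R := \sum_r \sum_s V p r s * V q s r.

Let tr_killing y z : \tr (M y *m M z) =
  \sum_p y 0 p * \sum_q z 0 q * killing p q.
Proof.
rewrite trM; apply: eq_bigr => p _; congr (_ * _).
under [RHS]eq_bigr => q _ do rewrite mulr_sumr.
rewrite [RHS]exchange_big; apply: eq_bigr => s _ /=.
under [RHS]eq_bigr => q _ do rewrite mulr_sumr.
rewrite [RHS]exchange_big; apply: eq_bigr => t _ /=.
by rewrite mxE mulr_sumr; apply: eq_bigr => q _; ring.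
Qed.

Lemma evaluate_tF : evaluate (tF V) xi = \tr (M v *m M v).
Proof.
rewrite evaluate_symmetrise evaluate_sum tr_killing; apply: eq_bigr => p _.
rewrite evaluate_sum mulr_sumr; apply: eq_bigr => q _.
rewrite evaluate_sum /killing !mulr_sumr; apply: eq_bigr => r _.
rewrite evaluate_sum !mulr_sumr; apply: eq_bigr => s _.
transitivity (V p r s * V q s r * evaluate (fun i : 'I_4 -> 'I_3 =>
    V (i 0) (i 1) p * V (i 2) (i 3) q) xi).
  by rewrite -evaluate_scale; congr evaluate; apply/funext => i; ring.
by rewrite (evaluate22 (fun a b => V a b p) (fun a b => V a b q)) !vE; ring.
Qed.

Lemma evaluate_tJ : evaluate (tJ V) xi = \tr (M (v *m M v *m m) *m m).
Proof.
rewrite evaluate_symmetrise evaluate_sum trM sum_mul sum_contraction.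
apply: eq_bigr => p _; rewrite evaluate_sum mulr_sumr.
apply: eq_bigr => q _; rewrite evaluate_sum !mulr_sumr.
apply: eq_bigr => r _; rewrite evaluate_sum !mulr_sumr.
apply: eq_bigr => s _; rewrite evaluate_sum !mulr_sumr.
apply: eq_bigr => t _; rewrite evaluate_sum !mulr_sumr.
apply: eq_bigr => u _.
transitivity (V p q r * V s t u * evaluate (fun i : 'I_6 -> 'I_3 =>
    V (i 0) (i 1) p * V (i 2) (i 3) q * V (i 4) r s * V (i 5) u t) xi).
  by rewrite -evaluate_scale; congr evaluate; apply/funext => i; ring.
rewrite (evaluate2211 (fun a b => V a b p) (fun a b => V a b q)
  (fun a => V a r s) (fun a => V a u t)).
by rewrite !vE !mE; ring.
Qed.

Lemma evaluate_tK : evaluate (tK V) xi = \tr (M (v *m m) *m M (v *m m)).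
Proof.
rewrite evaluate_symmetrise evaluate_sum tr_killing sum_mul.
apply: eq_bigr => p _; rewrite evaluate_sum mulr_sumr.
under [RHS]eq_bigr do rewrite sum_mul !mulr_sumr.
rewrite [RHS]exchange_big /=.
apply: eq_bigr => q _; rewrite evaluate_sum.
apply: eq_bigr => r _; rewrite evaluate_sum !mulr_sumr.
apply: eq_bigr => s _; rewrite evaluate_sum /killing !mulr_sumr.
apply: eq_bigr => t _; rewrite evaluate_sum !mulr_sumr.
apply: eq_bigr => u _.
transitivity (V r t u * V s u t * evaluate (fun i : 'I_6 -> 'I_3 =>
    V (i 0) (i 1) p * V (i 2) (i 3) q * V (i 4) p r * V (i 5) q s) xi).
  by rewrite -evaluate_scale; congr evaluate; apply/funext => i; ring.
rewrite (evaluate2211 (fun a b => V a b p) (fun a b => V a b q)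
  (fun a => V a p r) (fun a => V a q s)).
by rewrite !vE !mE; ring.
Qed.

Lemma evaluate_tL : evaluate (tL V) xi = \tr (M (v *m M v) *m m *m m).
Proof.
rewrite evaluate_symmetrise evaluate_sum -mulmxA trM sum_contraction.
apply: eq_bigr => p _; rewrite evaluate_sum mulr_sumr.
apply: eq_bigr => q _; rewrite evaluate_sum !mulr_sumr.
apply: eq_bigr => r _; rewrite evaluate_sum !mulr_sumr.
apply: eq_bigr => s _; rewrite evaluate_sum !mulr_sumr.
apply: eq_bigr => t _; rewrite evaluate_sum [(m *m m) _ _]mxE !mulr_sumr.
apply: eq_bigr => u _.
transitivity (V p q r * V r s t * evaluate (fun i : 'I_6 -> 'I_3 =>
    V (i 0) (i 1) p * V (i 2) (i 3) q * V (i 4) t u * V (i 5) u s) xi).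
  by rewrite -evaluate_scale; congr evaluate; apply/funext => i; ring.
rewrite (evaluate2211 (fun a b => V a b p) (fun a b => V a b q)
  (fun a => V a t u) (fun a => V a u s)).
by rewrite !vE !mE; ring.
Qed.

Lemma evaluate_tT : evaluate (tT V) xi = obstruction_form M xi.
Proof.
rewrite /obstruction_form -/m -/v -evaluate_tJ -evaluate_tK -evaluate_tL.
rewrite -evaluate_tF -evaluate_tD -evaluate_tC -evaluate_tB -evaluate_tA.
rewrite !expr2 -!evaluate_odot -!evaluate_scale.
rewrite /evaluate -!sumrN -!big_split; apply: eq_bigr => f _ /=.
by rewrite /tT; ring.
Qed.

Lemma symmetriseK k (P : tensor R k) : symmetrise (symmetrise P) = symmetrise P.
Proof.
apply/funext => i; rewrite {1}/symmetrise.
have E (s : 'S_k) : symmetrise P (fun m => i (s m)) = symmetrise P i.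
  rewrite /symmetrise; congr (_ * _).
  rewrite [RHS](reindex_inj (mulIg s)); apply: eq_bigr => t _.
  by congr P; apply/funext => n; rewrite permM.
under eq_bigr do rewrite E.
rewrite sumr_const card_Sn -[X in _ * X]mulr_natl mulrA mulVf ?mul1r //
  pnatr_eq0 -lt0n fact_gt0.
Qed.

Lemma symmetriseD k (P Q : tensor R k) c :
  symmetrise (fun i => P i + c * Q i) = fun i => symmetrise P i + c * symmetrise Q i.
Proof.
apply/funext => i; rewrite /symmetrise mulrCA -mulrDr; congr (_ * _).
by rewrite mulr_sumr -big_split.
Qed.

Lemma symmetrise_tT : symmetrise (tT V) = tT V.
Proof.
have -> : tT V = fun i => 0 + 24 * tJ V i + 12 * tK V i + -24 * tL V i
  + -24 * odot (tB V) (tB V) i + -24 * odot (tC V) (tC V) i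
  + 40 * odot (tB V) (tC V) i + -24 * odot (tA V) (tD V) i
  + 6 * odot (tA V) (tF V) i.
  by apply/funext => i; rewrite /tT; ring.
rewrite !symmetriseD /odot !symmetriseK; apply/funext => i.
by rewrite /symmetrise big1 ?mulr0.
Qed.

End Components.

(** T is symmetric, so its vanishing can be tested on covectors. *)
Lemma tT_eq0 (R : realType) (V : 'I_3 -> 'I_3 -> 'I_3 -> R) :
  (forall xi, obstruction_form (contraction V) xi = 0) -> tT V = fun=> 0.
Proof.
by move=> T0; rewrite -symmetrise_tT; apply: polarisation => z; rewrite evaluate_tT.
Qed.

Section Pencils.
Variable R : realType.

Lemma contraction_pencil (V : 'I_3 -> 'I_3 -> 'I_3 -> R) (G H : 'I_3 -> 'I_3 -> R) :
  (forall a b, G a b = G b a) -> (forall a b, H a b = H b a) ->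
  (forall a b c, V a b c =
    \sum_f \sum_h eta R c f h * (G h a * H f b + G h b * H f a)) ->
  contraction V = pencil_mx (\matrix_(a, b) G a b) (\matrix_(a, b) H a b).
Proof.
move=> symG symH VE; apply/funext => xi; apply/matrixP => b c.
have [] := @pencil_mxE _ (\matrix_(a, b) G a b) (\matrix_(a, b) H a b) xi _ _ b.
- by apply/matrixP => p q; rewrite !mxE.
- by apply/matrixP => p q; rewrite !mxE.
move: (pencil_mx _ _ xi) => p; rewrite !mxE => E0 E1 E2; rewrite sum3 !VE !sum3.
rewrite !(symG _ b) !(symH _ b).
by elim/ord3_ind: c; rewrite ?E0 ?E1 ?E2 /eta /=
  !(symG o1 o0) !(symG o2 o0) !(symG o2 o1)
  !(symH o1 o0) !(symH o2 o0) !(symH o2 o1); ring.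
Qed.

Lemma tT_pencil (V : 'I_3 -> 'I_3 -> 'I_3 -> R) (G H : 'I_3 -> 'I_3 -> R) :
  (forall a b, G a b = G b a) -> (forall a b, H a b = H b a) ->
  (forall a b c, V a b c =
    \sum_f \sum_h eta R c f h * (G h a * H f b + G h b * H f a)) ->
  tT V = fun=> 0.
Proof.
move=> symG symH VE; apply: tT_eq0 => xi.
rewrite (contraction_pencil symG symH VE).
by apply: pencil_obstruction; apply/matrixP => a b; rewrite !mxE.
Qed.
End Pencils.

(** * Symmetry of second derivatives *)

Section Schwarz.
Variables (R : realType) (V : normedModType R).
Implicit Types (f : V -> R) (x u v : V).

Lemma is_derive_line f x u (s : R) : derivable f (s *: u + x) u ->
  is_derive s 1 (fun t : R => f (t *: u + x)) ('D_u f (s *: u + x)).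
Proof.
have E : (fun h : R => h^-1 *:
    (((fun t : R => f (t *: u + x)) \o shift s) (h *: (1 : R)) - f (s *: u + x)))
  = (fun h : R => h^-1 *: ((f \o shift (s *: u + x)) (h *: u) - f (s *: u + x))).
  apply/funext => h /=; congr (_ *: (f _ - _)).
  by rewrite addrA -scalerDl [h *: (1 : R)]mulr1.
move=> df; split; first by rewrite /derivable E.
by rewrite /derive E.
Qed.

Lemma mean_value_line f x u (h : R) : 0 < h ->
  (forall s, s \in `[0, h] -> derivable f (s *: u + x) u) ->
  exists2 s, s \in `[0, h] & f (h *: u + x) - f x = 'D_u f (s *: u + x) * h.
Proof.
move=> h0 df.
have [||s sh] := @MVT_segment R (fun t => f (t *: u + x))
  (fun s => 'D_u f (s *: u + x)) 0 h (ltW h0).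
- move=> s sh; apply: is_derive_line; apply: df.
  by rewrite in_itv /= !ltW ?(itvP sh).
- apply: derivable_within_continuous => s sh.
  by have [] := is_derive_line (df s sh).
by rewrite subr0 scale0r add0r => E; exists s.
Qed.

(** The mean value theorem applied to y |-> f (h v + y) - f y along u, then to
the derivative of f along v. *)
Lemma second_difference f x u v (h : R) : 0 < h ->
  (forall s t, s \in `[0, h] -> t \in `[0, h] ->
    derivable f (s *: u + t *: v + x) u /\
    derivable ('D_u f) (s *: u + t *: v + x) v) ->
  exists s t, [/\ s \in `[0, h], t \in `[0, h] &
    f (h *: u + h *: v + x) - f (h *: u + x) - f (h *: v + x) + f x =
    'D_v ('D_u f) (s *: u + t *: v + x) * (h * h)].
Proof.
move=> h0 df.
have h00 : (0 : R) \in `[0, h] by rewrite in_itv /= lexx ltW.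
have hh : h \in `[0, h] by rewrite in_itv /= lexx ltW.
pose g y := f (h *: v + y) - f y.
have dg s : s \in `[0, h] ->
  is_derive (s *: u + x) u g ('D_u f (h *: v + (s *: u + x)) - 'D_u f (s *: u + x)).
  move=> sh; have [d1 _] := df s h sh hh; have [d2 _] := df s 0 sh h00.
  rewrite scale0r addr0 in d2.
  rewrite [_ *: u + _]addrC -addrA in d1.
  have s1 : is_derive (s *: u + x) u (fun y => f (h *: v + y)) ('D_u f (h *: v + (s *: u + x))).
    have E : (fun k : R => k^-1 *:
          (((fun y => f (h *: v + y)) \o shift (s *: u + x)) (k *: u)
           - f (h *: v + (s *: u + x))))
      = (fun k : R => k^-1 *:
          ((f \o shift (h *: v + (s *: u + x))) (k *: u)
           - f (h *: v + (s *: u + x)))).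
      by apply/funext => k /=; congr (_ *: (f _ - _)); rewrite addrCA.
    by split; [rewrite /derivable E | rewrite /derive E].
  by apply: is_deriveB => //; apply/derivableP.
have [s' s'h|s sh Es] := @mean_value_line g x u h h0; first by have [] := dg _ s'h.
rewrite (@derive_val _ _ _ _ _ _ _ (dg s sh)) in Es.
have [t th|t th Et] := @mean_value_line ('D_u f) (s *: u + x) v h h0.
  by have [_] := df s t sh th; rewrite [_ *: u + _]addrC -addrA.
exists s, t; split=> //.
have swap a c : a *: u + c *: v + x = c *: v + (a *: u + x).
  by rewrite [_ *: u + _]addrC addrA.
by rewrite !swap mulrA -Et -Es /g opprB [RHS]addrA [RHS]addrAC.
Qed.

(** Schwarz: the second difference is symmetric in u and v, so both mixed
derivatives take a common value arbitrarily close to x. *)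
Lemma derive_comm f x u v :
  (\forall y \near x, derivable f y u /\ derivable ('D_u f) y v) ->
  (\forall y \near x, derivable f y v /\ derivable ('D_v f) y u) ->
  {for x, continuous ('D_v ('D_u f))} -> {for x, continuous ('D_u ('D_v f))} ->
  'D_v ('D_u f) x = 'D_u ('D_v f) x.
Proof.
move=> duv dvu cuv cvu; apply/eqP; rewrite -subr_eq0 -normr_eq0; apply/negP => /negP ne.
set A := 'D_v ('D_u f) x in ne *; set B := 'D_u ('D_v f) x in ne *.
pose e := `|A - B| / 2.
have e0 : 0 < e by rewrite divr_gt0 // lt_def ne normr_ge0.
have nA : \forall y \near x, `|A - 'D_v ('D_u f) y| < e.
  by move/cvgrPdist_lt: cuv => /(_ e e0).
have nB : \forall y \near x, `|B - 'D_u ('D_v f) y| < e.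
  by move/cvgrPdist_lt: cvu => /(_ e e0).
have [r /= r0 near_x] :=
  (nbhs_ballP _ _).1 (filterI (filterI duv dvu) (filterI nA nB)).
(* The box of side h spanned by u and v at x fits in the ball of radius r. *)
pose h := r / 2 / (`|u| + `|v| + 1).
have n0 : 0 < `|u| + `|v| + 1 by rewrite ltr_pwDr // addr_ge0.
have h0 : 0 < h by rewrite !divr_gt0.
have box s t : s \in `[0, h] -> t \in `[0, h] -> ball x r (s *: u + t *: v + x).
  move=> sh th; rewrite -ball_normE /ball_ /= opprD addrCA subrr addr0 normrN.
  apply: le_lt_trans (ler_normD _ _) _; rewrite !normrZ.
  rewrite !ger0_norm ?(itvP sh) ?(itvP th) //.
  apply: (@le_lt_trans _ _ (h * (`|u| + `|v| + 1))).
    rewrite !mulrDr mulr1 -[leLHS]addr0 lerD ?(ltW h0) //.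
    by rewrite lerD // ler_wpM2r ?(itvP sh) ?(itvP th).
  by rewrite divfK ?gt_eqF // ltr_pdivrMr // mulr2n mulrDr mulr1 ltrDl.
have [s [t [sh th E1]]] := @second_difference f x u v h h0
  (fun s t sh th => (near_x _ (box s t sh th)).1.1).
have [s' t' sh' th'|t' [s' [th' sh' E2]]] := @second_difference f x v u h h0.
  by rewrite [s' *: v + _]addrC; exact: (near_x _ (box _ _ th' sh')).1.2.
have E : 'D_v ('D_u f) (s *: u + t *: v + x) = 'D_u ('D_v f) (s' *: u + t' *: v + x).
  have hh0 : h * h != 0 by rewrite gt_eqF // mulr_gt0.
  apply: (mulIf hh0); rewrite -E1 [s' *: u + _]addrC -E2.
  by rewrite [h *: v + h *: u]addrC; congr (_ + f x); rewrite addrAC.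
have [_ [a1 _]] := near_x _ (box s t sh th).
have [_ [_ b1]] := near_x _ (box s' t' sh' th').
have e2 : `|A - B| = e + e by rewrite -splitr.
rewrite -E in b1; clearbody e A B.
have := le_lt_trans (ler_distD _ A B) (ltrD a1 (_ : `|_ - B| < e)).
by rewrite e2 ltxx distrC => /(_ b1).
Qed.
End Schwarz.

(** * Curvature in a chart *)

Section Curvature.
Variable R : realType.
Implicit Types (U : set 'rV[R]_3) (f : 'rV[R]_3 -> R) (x : 'rV[R]_3).

Lemma smooth_derivable U f x (a : 'I_3) : smooth_on U f -> U x ->
  derivable f x (delta_mx 0 a : 'rV[R]_3).
Proof. by move=> /(_ 1%N)[_ /(_ a)[df _]]; exact: df. Qed.

Lemma smooth_partial U f a : smooth_on U f -> smooth_on U (partial a f).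
Proof. by move=> sf n; have [_ /(_ a)[]] := sf n.+1. Qed.

Lemma smooth_continuous U f x : smooth_on U f -> U x -> {for x, continuous f}.
Proof. by move=> /(_ 0%N)[cf _]; exact: cf. Qed.

Lemma smooth_cst U (k : R) : smooth_on U (fun=> k).
Proof.
move=> n; elim: n k => [|n IH] k; split=> //; first by move=> x _; exact: cst_continuous.
  by move=> x _; exact: cst_continuous.
move=> a; split=> [x _ |]; first exact: derivable_cst.
have -> : partial a (fun=> k) = fun=> 0; last exact: IH.
by apply/funext => x; exact: derive_cst.
Qed.

Lemma partial_comm U f x a b : open U -> smooth_on U f -> U x ->
  partial a (partial b f) x = partial b (partial a f) x.
Proof.
move=> oU sf Ux; have near_U : \forall y \near x, U y by exact: open_nbhs_nbhs.
apply: (@derive_comm _ _ f x (delta_mx 0 b) (delta_mx 0 a)).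
- apply: filterS near_U => y Uy; split; first exact: (smooth_derivable sf Uy).
  exact: (smooth_derivable (smooth_partial _ sf) Uy).
- apply: filterS near_U => y Uy; split; first exact: (smooth_derivable sf Uy).
  exact: (smooth_derivable (smooth_partial _ sf) Uy).
- by apply: (smooth_continuous _ Ux); do 2!apply: smooth_partial.
- by apply: (smooth_continuous _ Ux); do 2!apply: smooth_partial.
Qed.

Lemma is_derive_fun_add f g x v (df dg : R) :
  is_derive x v f df -> is_derive x v g dg ->
  is_derive x v (fun z => f z + g z) (df + dg).
Proof. by move=> hf hg; apply: is_deriveD. Qed.

Lemma is_derive_fun_mul f g x v (df dg : R) :
  is_derive x v f df -> is_derive x v g dg ->
  is_derive x v (fun z => f z * g z) (f x * dg + g x * df).
Proof. by move=> hf hg; apply: is_deriveM. Qed.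

Lemma is_derive_fun_sum (F : 'I_3 -> 'rV[R]_3 -> R) x v (dF : 'I_3 -> R) :
  (forall e, is_derive x v (F e) (dF e)) ->
  is_derive x v (fun z => \sum_e F e z) (\sum_e dF e).
Proof.
move=> dh; rewrite (_ : (fun z => _) = \sum_e F e); first exact: is_derive_sum.
by apply/funext => z; rewrite fct_sumE.
Qed.

Lemma smooth_is_derive U f x a : smooth_on U f -> U x ->
  is_derive x (delta_mx 0 a : 'rV[R]_3) f (partial a f x).
Proof. by move=> sf Ux; apply/derivableP; exact: smooth_derivable sf Ux. Qed.

Lemma partialE f x a d :
  is_derive x (delta_mx 0 a : 'rV[R]_3) f d -> partial a f x = d.
Proof. by case. Qed.

Lemma partial_near U f g x a : open U -> U x -> {in U, f =1 g} ->
  partial a f x = partial a g x.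
Proof.
move=> oU Ux fg; apply: near_eq_derive.
have near_U : \forall y \near x, U y by exact: open_nbhs_nbhs.
by apply: filterS near_U => y Uy; apply: fg; rewrite inE.
Qed.

Variable M : manifold3 R.
Implicit Types (N : connection M) (i : chart M).

Definition curvature N i x (a b c d : 'I_3) : R :=
  partial a (fun z => N i z b d c) x - partial b (fun z => N i z a d c) x
  + \sum_e (N i x a e c * N i x b d e - N i x b e c * N i x a d e).

(** The derivatives of X cancel because second partial derivatives commute and
the Christoffel symbols are symmetric. *)
Lemma ricci_identity N : torsion_free N -> is_curvature N (curvature N).
Proof.
move=> tN i X sX x a b c xi.
have d1 p q : partial p (fun z => nabla_vect N i X z q c) x =
    partial p (partial q (fun z => X z c)) x +
    \sum_e (N i x q e c * partial p (fun z => X z e) x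
            + X x e * partial p (fun z => N i z q e c) x).
  apply: partialE; apply: is_derive_fun_add.
    by apply: (smooth_is_derive _ _ xi); apply: smooth_partial.
  apply: is_derive_fun_sum => e; apply: is_derive_fun_mul.
    exact: (smooth_is_derive _ (christoffel_smooth N i q e c) xi).
  exact: (smooth_is_derive _ (sX e) xi).
rewrite /nabla_endo !d1 (partial_comm a b (@open_cod _ _ i) (sX c) xi).
rewrite /curvature /nabla_vect !sum3 !(tN i x b a _ xi); ring.
Qed.

(** Test the defining equation on constant coordinate fields. *)
Lemma curvature_unique N
    (Rm Rm' : chart M -> 'rV[R]_3 -> 'I_3 -> 'I_3 -> 'I_3 -> 'I_3 -> R)
    i x a b c d :
  is_curvature N Rm -> is_curvature N Rm' -> cod i x ->
  Rm i x a b c d = Rm' i x a b c d.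
Proof.
move=> hR hR' xi.
have sX : smooth_vector i (fun (_ : 'rV[R]_3) e => kron R e d).
  by move=> e; exact: smooth_cst.
have := hR i _ sX x a b c xi; rewrite (hR' i _ sX x a b c xi).
by rewrite !sum_kron => ->.
Qed.

Lemma curvature_skew N i x a b c d : curvature N i x b a c d = - curvature N i x a b c d.
Proof. by rewrite /curvature !sum3; ring. Qed.

Lemma partial_christoffel_sym N i x a b c d : torsion_free N -> cod i x ->
  partial a (fun z => N i z c b d) x = partial a (fun z => N i z b c d) x.
Proof.
move=> tN xi; apply: (partial_near _ (@open_cod _ _ i) xi) => z; rewrite inE => zi.
exact: tN.
Qed.

Lemma curvature_bianchi N i x a b c d : torsion_free N -> cod i x ->
  curvature N i x a b c d + curvature N i x b d c a + curvature N i x d a c b = 0.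
Proof.
move=> tN xi; rewrite /curvature.
rewrite (partial_christoffel_sym a b d c tN xi) (partial_christoffel_sym b a d c tN xi).
rewrite (partial_christoffel_sym d a b c tN xi) !sum3.
rewrite !(tN i x d b _ xi) !(tN i x d a _ xi) !(tN i x b a _ xi); ring.
Qed.
End Curvature.

(** * Pointwise algebra of the Weyl tensor *)

Section PointwiseWeyl.
Variable R : realType.
Notation tensor3 := ('I_3 -> 'I_3 -> 'I_3 -> R).
Notation tensor4 := ('I_3 -> 'I_3 -> 'I_3 -> 'I_3 -> R).
Implicit Types (Rm W L : tensor4) (P G E : 'I_3 -> 'I_3 -> R) (eps : tensor3).

(** What the Schouten tensor P contributes to the curvature besides the Weyl
tensor, with beta_ab = P_ba - P_ab. *)
Definition weyl_remainder P (a b c d : 'I_3) : R :=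
  kron R a c * P b d - kron R b c * P a d - (P a b - P b a) * kron R d c.

Lemma trivector_eta eps :
  (forall a b c, eps b a c = - eps a b c) ->
  (forall a b c, eps a c b = - eps a b c) ->
  exists k, forall a b c, eps a b c = k * eta R a b c.
Proof.
move=> s12 s23; exists (eps o0 o1 o2).
have z12 a c : eps a a c = 0 by apply/eqP; rewrite -eqNr -s12.
have z23 a c : eps c a a = 0 by apply/eqP; rewrite -eqNr -s23.
have z13 a c : eps a c a = 0 by rewrite s23 z12 oppr0.
have e021 : eps o0 o2 o1 = - eps o0 o1 o2 by rewrite s23.
have e102 : eps o1 o0 o2 = - eps o0 o1 o2 by rewrite s12.
have e120 : eps o1 o2 o0 = eps o0 o1 o2 by rewrite s23 e102 opprK.
have e201 : eps o2 o0 o1 = eps o0 o1 o2 by rewrite s12 e021 opprK.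
have e210 : eps o2 o1 o0 = - eps o0 o1 o2 by rewrite s12 e120.
by elim/ord3_ind; elim/ord3_ind; elim/ord3_ind;
  rewrite /eta /= ?z12 ?z23 ?z13 ?e021 ?e102 ?e120 ?e201 ?e210
          ?mulr0 ?mulr1 ?mulrN1.
Qed.

(** In dimension three a skew 2-tensor is the dual of a vector. *)
Lemma skew_dual (s : 'I_3 -> 'I_3 -> R) : (forall a b, s b a = - s a b) ->
  forall a b, s a b = \sum_e eta R a b e * (2^-1 * \sum_p \sum_q eta R e p q * s p q).
Proof.
move=> sk.
have z a : s a a = 0 by apply/eqP; rewrite -eqNr -sk.
move=> a b; rewrite !sum3.
rewrite !z (sk o0 o1) (sk o0 o2) (sk o1 o2).
elim/ord3_ind: a; elim/ord3_ind: b; rewrite /eta /= ?z ?(sk o0 o1) ?(sk o0 o2) ?(sk o1 o2).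
all: by field.
Qed.

(** The hypotheses describe a curvature tensor at a point with its projective
decomposition; from [G] and [L] on, it is moreover the curvature of a metric
with inverse [G], and [L] is its lowered form. *)
Section Decomposition.
Variables (Rm W : tensor4) (P : 'I_3 -> 'I_3 -> R).
Hypothesis RmE : forall a b c d, Rm a b c d = W a b c d + weyl_remainder P a b c d.
Hypothesis Rm_skew : forall a b c d, Rm b a c d = - Rm a b c d.
Hypothesis Rm_bianchi : forall a b c d, Rm a b c d + Rm b d c a + Rm d a c b = 0.
Hypothesis W_trace : forall b d, \sum_a W a b a d = 0.

Lemma weyl_skew a b c d : W b a c d = - W a b c d.
Proof.
have := Rm_skew a b c d; rewrite !RmE /weyl_remainder => E; lra.
Qed.

Lemma weyl_bianchi a b c d : W a b c d + W b d c a + W d a c b = 0.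
Proof.
have := Rm_bianchi a b c d; rewrite !RmE /weyl_remainder => E; lra.
Qed.

Let V a b c := \sum_d \sum_e eta R d e a * W d e b c.

Let Vdef b c : [/\ V o0 b c = 2 * W o1 o2 b c, V o1 b c = 2 * W o2 o0 b c &
  V o2 b c = 2 * W o0 o1 b c].
Proof.
rewrite /V !sum3; split; rewrite /eta /=
  ?(weyl_skew o1 o2) ?(weyl_skew o2 o0) ?(weyl_skew o0 o1); ring.
Qed.

(** The skew part of V is the dual of a trace of W. *)
Lemma dual_weyl_sym a b c : V a b c = V b a c.
Proof.
have W0 p q r : W p p q r = 0 by apply/eqP; rewrite -eqNr -weyl_skew.
have t p : W o0 p o0 c + W o1 p o1 c + W o2 p o2 c = 0.
  by rewrite -(W_trace p c) sum3.
have t0 := t o0; have t1 := t o1; have t2 := t o2.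
rewrite !W0 in t0 t1 t2.
rewrite (weyl_skew o0 o1) in t0; rewrite (weyl_skew o1 o2) in t1.
rewrite (weyl_skew o2 o0) in t2.
have [_ A01 A02] := Vdef o0 c; have [A10 _ A12] := Vdef o1 c; have [A20 A21 _] := Vdef o2 c.
have E01 : V o0 o1 c = V o1 o0 c by rewrite A01 A10; congr (_ * _); lra.
have E02 : V o0 o2 c = V o2 o0 c by rewrite A02 A20; congr (_ * _); lra.
have E12 : V o1 o2 c = V o2 o1 c by rewrite A12 A21; congr (_ * _); lra.
by elim/ord3_ind: a; elim/ord3_ind: b.
Qed.

(** The trace of V is twice a cyclic sum of W. *)
Lemma dual_weyl_trace b : \sum_a V a b a = 0.
Proof.
rewrite sum3; have [-> _ _] := Vdef b o0; have [_ -> _] := Vdef b o1.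
have [_ _ ->] := Vdef b o2; rewrite -!mulrDr.
by rewrite (_ : _ + _ = 0) ?mulr0 //; have := weyl_bianchi o1 o2 b o0; lra.
Qed.

Variables (G : 'I_3 -> 'I_3 -> R) (L : tensor4).
Hypothesis G_sym : forall a b, G a b = G b a.
Hypothesis RmL : forall a b c d, Rm a b c d = \sum_h G c h * L a b h d.
Hypothesis L_skew : forall a b c d, L b a c d = - L a b c d.
Hypothesis L_skew' : forall a b c d, L a b d c = - L a b c d.
Hypothesis L_bianchi : forall a b c d, L a b c d + L b d c a + L d a c b = 0.

(* The double dual of L, that is - det(g) times the Einstein tensor. *)
Let E e f : R := 2^-1 * \sum_p \sum_q eta R e p q *
  (2^-1 * \sum_r \sum_s eta R f r s * L p q r s).

Let LE a b c d : L a b c d = \sum_e \sum_f eta R a b e * eta R c d f * E e f.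
Proof.
rewrite (@skew_dual (fun c d => L a b c d) (L_skew' a b) c d).
rewrite exchange_big; apply: eq_bigr => f _.
have sk p q : 2^-1 * (\sum_r \sum_s eta R f r s * L q p r s) =
     - (2^-1 * (\sum_r \sum_s eta R f r s * L p q r s)).
  rewrite -mulrN -sumrN; congr (_ * _); apply: eq_bigr => r _.
  by rewrite -sumrN; apply: eq_bigr => s _; rewrite L_skew mulrN.
rewrite (skew_dual sk a b) mulr_sumr; apply: eq_bigr => e _.
by rewrite -/(E e f) mulrCA mulrA.
Qed.

(** The Bianchi identity on three distinct indices says just this. *)
Let E_sym e f : E e f = E f e.
Proof.
have B0 := L_bianchi o1 o2 o2 o0; have B1 := L_bianchi o2 o0 o0 o1.
have B2 := L_bianchi o0 o1 o1 o2.
rewrite !LE !sum3 /eta /= in B0 B1 B2.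
by elim/ord3_ind: e; elim/ord3_ind: f => //; lra.
Qed.

(** Besides the curvature part T, the formula for V contains a skew term and a
term p^a delta^b_c coming from the Schouten tensor. Symmetrising kills the
former, and the trace kills p, since the curvature part is trace-free. *)
Lemma dual_weyl_pencil : exists H : 'I_3 -> 'I_3 -> R,
  (forall a b, H a b = H b a) /\
  forall a b c, V a b c = \sum_f \sum_h eta R c f h * (G h a * H f b + G h b * H f a).
Proof.
exists E; split=> [|a b c]; first exact: E_sym.
pose p a := \sum_d \sum_e eta R d e a * P d e.
pose T a b c := \sum_f \sum_h eta R c f h * (G h b * E f a).
have VE x y z : V x y z = 2 * T x y z + 2 * p x * kron R y z
    - 2 * \sum_e eta R y e x * P e z.
  have WE d e u w : W d e u w = Rm d e u w - weyl_remainder P d e u w.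
    by rewrite RmE addrK.
  rewrite /V !sum3 !WE !RmL !sum3 !LE !sum3 /T /p !sum3 /weyl_remainder.
  rewrite (E_sym o1 o0) (E_sym o2 o0) (E_sym o2 o1).
  by elim/ord3_ind: x; elim/ord3_ind: y; elim/ord3_ind: z;
    rewrite ?(G_sym o1 o0) ?(G_sym o2 o0) ?(G_sym o2 o1);
    rewrite ?(E_sym o1 o0) ?(E_sym o2 o0) ?(E_sym o2 o1) /eta /kron /=; ring.
have V2 x y z : V x y z = T x y z + T y x z + p x * kron R y z + p y * kron R x z.
  have swap : \sum_e eta R x e y * P e z = - \sum_e eta R y e x * P e z.
    rewrite -sumrN; apply: eq_bigr => e _; rewrite -mulNr; congr (_ * _).
    by elim/ord3_ind: x; elim/ord3_ind: y; elim/ord3_ind: e; rewrite /eta /= ?oppr0 ?opprK.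
  have := VE x y z; have := VE y x z; rewrite swap -(dual_weyl_sym x y z) -/(V x y z).
  move: (\sum_e _) => S E1 E2; lra.
have p0 y : p y = 0.
  have := dual_weyl_trace y; rewrite -/(V _ _ _).
  under eq_bigr do rewrite -/(V _ _ _) V2.
  rewrite sum3 /T !sum3.
  elim/ord3_ind: y; rewrite ?(G_sym o1 o0) ?(G_sym o2 o0) ?(G_sym o2 o1);
    rewrite ?(E_sym o1 o0) ?(E_sym o2 o0) ?(E_sym o2 o1) /eta /kron /=;
    move: (p o0) (p o1) (p o2) => p0 p1 p2; lra.
rewrite -/(V a b c) V2 !p0 !mul0r !addr0 /T -big_split; apply: eq_bigr => f _ /=.
by rewrite -big_split; apply: eq_bigr => h _ /=; ring.
Qed.
End Decomposition.
End PointwiseWeyl.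

(** * Projective changes and metrics *)

Section ProjectiveAndMetric.
Variables (R : realType) (M : manifold3 R).
Implicit Types (N : connection M) (i : chart M) (x : 'rV[R]_3).

Lemma nabla_vect_frame N i b x a c :
  nabla_vect N i (fun _ e => kron R e b) x a c = N i x a b c.
Proof.
by rewrite /nabla_vect sum_kron (_ : partial _ _ _ = 0) ?add0r //; apply: derive_cst.
Qed.

Lemma is_derive_fun_scale (f : 'rV[R]_3 -> R) x v (k df : R) :
  is_derive x v f df -> is_derive x v (fun z => k * f z) (k * df).
Proof. by move=> hf; apply: is_deriveZ. Qed.

Lemma sum_projective (n m y : 'I_3 -> R) (ya yb yd k : R) b c d :
  \sum_e (n e + kron R e c * ya + k * y e) * (m e + kron R d e * yb + kron R b e * yd) =
  \sum_e n e * m e + yb * n d + yd * n b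
  + ya * (m c + yb * kron R d c + yd * kron R b c)
  + k * (\sum_e y e * m e + (yb * y d + y b * yd)).
Proof.
rewrite !sum3.
by elim/ord3_ind: b; elim/ord3_ind: c; elim/ord3_ind: d; rewrite /kron /=; ring.
Qed.

(** The change is absorbed by the Schouten tensor: with Y the 1-form of the
projective equivalence, P_bd becomes P_bd - nabla_b Y_d + Y_b Y_d. *)
Lemma curvature_projective N N' i x : torsion_free N ->
  projectively_equivalent N N' -> cod i x ->
  exists Q, forall a b c d, curvature N' i x a b c d =
    curvature N i x a b c d + weyl_remainder Q a b c d.
Proof.
move=> tN [Y NY] xi.
have N'E z a b c : cod i z -> N' i z a b c =
    N i z a b c + kron R b c * Y i z a + kron R a c * Y i z b.
  move=> zi; have sX : smooth_vector i (fun (_ : 'rV[R]_3) e => kron R e b).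
    by move=> e; exact: smooth_cst.
  have := NY i _ sX z a c zi; rewrite !nabla_vect_frame sum_kron => ->.
  by rewrite /kron [c == b]eq_sym [Y i z a * _]mulrC.
have dN' a b c d : partial a (fun z => N' i z b d c) x =
    partial a (fun z => N i z b d c) x
    + kron R d c * partial a (fun z => Y i z b) x
    + kron R b c * partial a (fun z => Y i z d) x.
  have dY e := smooth_is_derive a (oneform_smooth Y i e) xi.
  rewrite (partial_near (g := fun z =>
     N i z b d c + kron R d c * Y i z b + kron R b c * Y i z d) a (@open_cod _ _ i) xi).
    have dN := smooth_is_derive a (christoffel_smooth N i b d c) xi.
    exact: (partialE (is_derive_fun_add (is_derive_fun_add dN
      (is_derive_fun_scale _ (dY b))) (is_derive_fun_scale _ (dY d)))).
  by move=> z; rewrite inE => zi; exact: N'E.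
exists (fun b d => - partial b (fun z => Y i z d) x
  + \sum_e N i x b d e * Y i x e + Y i x b * Y i x d) => a b c d.
have quad p q : \sum_e N' i x p e c * N' i x q d e =
    \sum_e N i x p e c * N i x q d e + Y i x q * N i x p d c + Y i x d * N i x p q c
    + Y i x p * (N i x q d c + Y i x q * kron R d c + Y i x d * kron R q c)
    + kron R p c * (\sum_e N i x q d e * Y i x e + 2 * (Y i x q * Y i x d)).
  under eq_bigr do rewrite !N'E //.
  rewrite sum_projective.
  have -> : \sum_e Y i x e * N i x q d e = \sum_e N i x q d e * Y i x e.
    by apply: eq_bigr => e _; rewrite mulrC.
  ring.
have NC : \sum_e N i x b a e * Y i x e = \sum_e N i x a b e * Y i x e.
  by apply: eq_bigr => e _; rewrite (tN i x a b _ xi).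
rewrite /curvature !dN' /weyl_remainder !sumrB !quad NC (tN i x b a _ xi); ring.
Qed.

End ProjectiveAndMetric.

Section MetricCurvature.
Variables (R : realType) (M : manifold3 R).
Variables (g : metric M) (N : connection M) (i : chart M) (x : 'rV[R]_3).
Hypotheses (LC : levi_civita g N) (xi : cod i x).

Definition lowered_curvature (a b c d : 'I_3) : R :=
  \sum_e g i x c e * curvature N i x a b e d.

(** The commutator of two derivatives of g_cd, expressed with nabla g = 0, is
R_abcd + R_abdc; it vanishes because partial derivatives commute. *)
Lemma lowered_curvature_skew a b c d :
  lowered_curvature a b d c = - lowered_curvature a b c d.
Proof.
have [tN ng] := LC.
have Dg z p q r : cod i z -> partial p (fun y => g i y q r) z =
    \sum_e N i z p q e * g i z e r + \sum_e N i z p r e * g i z q e.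
  by move=> /(ng i z p q r)/eqP; rewrite /nabla_metric -addrA -opprD subr_eq0 => /eqP.
have DDg p q : partial p (partial q (fun y => g i y c d)) x =
    \sum_e (N i x q c e * partial p (fun y => g i y e d) x
            + g i x e d * partial p (fun y => N i y q c e) x) +
    \sum_e (N i x q d e * partial p (fun y => g i y c e) x
            + g i x c e * partial p (fun y => N i y q d e) x).
  rewrite (partial_near (g := fun z => \sum_e N i z q c e * g i z e d
     + \sum_e N i z q d e * g i z c e) p (@open_cod _ _ i) xi).
    have dN r e := smooth_is_derive p (christoffel_smooth N i q r e) xi.
    have dg r e := smooth_is_derive p (metric_smooth g i r e) xi.
    exact: (partialE (is_derive_fun_add
      (is_derive_fun_sum (fun e => is_derive_fun_mul (dN c e) (dg e d)))
      (is_derive_fun_sum (fun e => is_derive_fun_mul (dN d e) (dg c e))))).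
  by move=> z; rewrite inE; exact: Dg.
have := partial_comm a b (@open_cod _ _ i) (metric_smooth g i c d) xi.
rewrite !DDg => /eqP; rewrite -subr_eq0 => /eqP E.
apply/eqP; rewrite -addr_eq0 -[eqbRHS]E; apply/eqP.
rewrite /lowered_curvature /curvature !sum3 !(Dg _ _ _ _ xi) !sum3.
rewrite !(Defs.metric_sym g d _ xi) !(Defs.metric_sym g c _ xi).
ring.
Qed.

Lemma lowered_curvature_bianchi a b c d :
  lowered_curvature a b c d + lowered_curvature b d c a
  + lowered_curvature d a c b = 0.
Proof.
rewrite -!big_split big1 // => e _ /=.
by rewrite -!mulrDr (curvature_bianchi a b e d LC.1 xi) mulr0.
Qed.

Let gmx : 'M[R]_3 := \matrix_(a < 3, b < 3) g i x a b.

Lemma inverse_metric_sym : (invmx gmx)^T = invmx gmx.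
Proof.
rewrite trmx_inv; congr invmx; apply/matrixP => a b.
by rewrite !mxE (Defs.metric_sym _ _ _ xi).
Qed.

Lemma raise_curvature a b c d : curvature N i x a b c d =
  \sum_h invmx gmx c h * lowered_curvature a b h d.
Proof.
pose r : 'cV[R]_3 := \col_e curvature N i x a b e d.
have -> : curvature N i x a b c d = r c 0 by rewrite mxE.
rewrite -[r](mulKmx (metric_nondegenerate g xi)) mxE.
apply: eq_bigr => h _; congr (_ * _); rewrite mxE.
by apply: eq_bigr => e _; rewrite !mxE.
Qed.
End MetricCurvature.

Section Metrisable.
Variables (R : realType) (M : manifold3 R).
Variables (eps : volume_trivector M) (N : connection M).
Variable W : chart M -> 'rV[R]_3 -> 'I_3 -> 'I_3 -> 'I_3 -> 'I_3 -> R.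
Hypotheses (tN : torsion_free N) (NW : is_projective_weyl N W).
Variables (i : chart M) (x : 'rV[R]_3).
Hypothesis xi : cod i x.

Lemma weyl_decomposition : exists P,
  (forall a b c d, curvature N i x a b c d = W i x a b c d + weyl_remainder P a b c d) /\
  (forall b d, \sum_a W i x a b a d = 0).
Proof.
have [Rm [P [RmN /(_ i x xi) [E t1 _ _]]]] := NW.
exists (P i x); split=> // a b c d.
rewrite -(curvature_unique a b c d RmN (ricci_identity tN) xi) E /weyl_remainder.
by field.
Qed.

Lemma Vtensor_dual : exists k, forall a b c, Vtensor eps W i x a b c =
  k * \sum_d \sum_e eta R d e a * W i x d e b c.
Proof.
have [k epsE] := trivector_eta
  (fun a b c => trivector_skew12 eps a b c xi) (fun a b c => trivector_skew23 eps a b c xi).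
exists k => a b c; rewrite /Vtensor mulr_sumr; apply: eq_bigr => d _.
by rewrite mulr_sumr; apply: eq_bigr => e _; rewrite epsE mulrA.
Qed.

Lemma Vtensor_sym a b c : Vtensor eps W i x a b c = Vtensor eps W i x b a c.
Proof.
have [P [E t]] := weyl_decomposition; have [k Vk] := Vtensor_dual.
by rewrite !Vk (dual_weyl_sym E (fun a b => curvature_skew N i x a b) t a b c).
Qed.

Lemma Vtensor_trace b : \sum_(a < 3) Vtensor eps W i x a b a = 0.
Proof.
have [P [E t]] := weyl_decomposition; have [k Vk] := Vtensor_dual.
under eq_bigr do rewrite Vk.
rewrite -mulr_sumr (dual_weyl_trace E (fun a b => curvature_skew N i x a b)) ?mulr0 //.
by move=> *; apply: curvature_bianchi.
Qed.

(** The scale k of the trivector is absorbed in the second tensor. *)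
Lemma Vtensor_pencil (g : metric M) (LC : connection M) :
  levi_civita g LC -> projectively_equivalent N LC ->
  exists G H : 'I_3 -> 'I_3 -> R,
  [/\ forall a b, G a b = G b a, forall a b, H a b = H b a &
  forall a b c, Vtensor eps W i x a b c =
    \sum_f \sum_h eta R c f h * (G h a * H f b + G h b * H f a)].
Proof.
move=> gLC NLC.
have [P [E t]] := weyl_decomposition; have [k Vk] := Vtensor_dual.
have [Q EQ] := curvature_projective tN NLC xi.
pose P' a b := P a b + Q a b.
have E' a b c d : curvature LC i x a b c d = W i x a b c d + weyl_remainder P' a b c d.
  by rewrite EQ E /weyl_remainder /P'; ring.
pose G a b := invmx (\matrix_(a < 3, b < 3) g i x a b) a b.
have G_sym a b : G a b = G b a by rewrite /G -[in LHS](inverse_metric_sym g xi) mxE.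
have bianchi a b c d := curvature_bianchi a b c d gLC.1 xi.
have Lskew a b c d : lowered_curvature g LC i x b a c d = - lowered_curvature g LC i x a b c d.
  by rewrite -sumrN; apply: eq_bigr => e _; rewrite curvature_skew mulrN.
have [H [H_sym VH]] := dual_weyl_pencil E' (fun a b => curvature_skew LC i x a b) bianchi t
  G_sym (fun a b => raise_curvature g LC xi a b) Lskew
  (fun a b c d => lowered_curvature_skew gLC xi a b c d)
  (fun a b c d => lowered_curvature_bianchi gLC xi a b c d).
exists G, (fun a b => k * H a b); split=> // [a b|a b c]; first by rewrite H_sym.
rewrite Vk VH mulr_sumr; apply: eq_bigr => f _; rewrite mulr_sumr.
by apply: eq_bigr => h _; ring.
Qed.
End Metrisable.

(** * A connection with nonzero obstruction *)

Section WeylExistence.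
Variables (R : realType) (M : manifold3 R) (N : connection M).
Hypothesis tN : torsion_free N.

Definition ricci (i : chart M) x b d : R := \sum_a curvature N i x a b a d.

(** Inverts Ric_bd = 3 P_bd - P_db, the trace of the projective
decomposition. *)
Definition projective_schouten (i : chart M) x b d : R :=
  (3 * ricci i x b d + ricci i x d b) / 8.

Definition weyl_of (i : chart M) x a b c d : R :=
  curvature N i x a b c d - weyl_remainder (projective_schouten i x) a b c d.

(** The first trace vanishes by the choice of P; the second is its opposite by
skew symmetry, and the third follows from the Bianchi identity. *)
Lemma weyl_ofP : is_projective_weyl N weyl_of.
Proof.
exists (curvature N), projective_schouten; split; first exact: ricci_identity.
move=> i x xi; set P := projective_schouten i x.
have tr1 b d : \sum_a weyl_of i x a b a d = 0.
  have -> : \sum_a weyl_of i x a b a d =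
      ricci i x b d - \sum_a weyl_remainder P a b a d by rewrite sumrB.
  have -> : \sum_a weyl_remainder P a b a d = 3 * P b d - P d b.
    by elim/ord3_ind: b; elim/ord3_ind: d; rewrite sum3 /weyl_remainder /kron /=; ring.
  by rewrite /P /projective_schouten; field.
split=> [a b c d | // | a d | a b]; first by rewrite /weyl_of -/P /weyl_remainder; field.
- apply/eqP; rewrite -oppr_eq0 -sumrN; apply/eqP.
  rewrite -[RHS](tr1 a d); apply: eq_bigr => b _.
  by rewrite /weyl_of curvature_skew /weyl_remainder; ring.
- have -> : \sum_c weyl_of i x a b c c = \sum_c (curvature N i x a b c c)
      - \sum_c weyl_remainder P a b c c by rewrite sumrB.
  have -> : \sum_c weyl_remainder P a b c c = 4 * (P b a - P a b).
    by elim/ord3_ind: a; elim/ord3_ind: b; rewrite sum3 /weyl_remainder /kron /=; ring.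
  have -> : \sum_c curvature N i x a b c c = ricci i x b a - ricci i x a b.
    rewrite -sumrB; apply: eq_bigr => c _.
    have := curvature_bianchi a b c c tN xi; rewrite (curvature_skew N i x b c c a).
    by move/eqP; rewrite addrAC addr_eq0 => /eqP E; rewrite [RHS]addrC; lra.
  by rewrite /P /projective_schouten; field.
Qed.
End WeylExistence.

Section Example.
Variable R : realType.

Lemma is_derive_coord (x v : 'rV[R]_3) (a : 'I_3) :
  is_derive x v (fun z : 'rV[R]_3 => z 0 a) (v 0 a).
Proof.
have lim_quot : (fun h : R => h^-1 *:
    (((fun z : 'rV[R]_3 => z 0 a) \o shift x) (h *: v) - x 0 a)) @ 0^' --> v 0 a.
  apply: cvg_near_cst; near=> h.
  rewrite /= !mxE addrK /GRing.scale /= mulKf //.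
  by near: h; exact: nbhs_dnbhs_neq.
by split; [exact: (cvgP _ lim_quot) | exact: (cvg_lim _ lim_quot)].
Unshelve. all: by end_near. Qed.

Lemma smooth_linear U (f : 'rV[R]_3 -> R) (k : 'I_3 -> R) : continuous f ->
  (forall x a, is_derive x (delta_mx 0 a : 'rV[R]_3) f (k a)) -> smooth_on U f.
Proof.
have cU (g : 'rV[R]_3 -> R) : continuous g -> forall x, U x -> {for x, continuous g}.
  by move=> cg x _; exact: cg.
move=> cf df [|n]; split; [exact: cU | by [] | exact: cU | move=> a].
split=> [x _|]; first by have [] := df x a.
have -> : partial a f = fun=> k a; last exact: smooth_cst.
by apply/funext => x; apply: partialE.
Qed.

Lemma smooth_coord U (a : 'I_3) : smooth_on U (fun z : 'rV[R]_3 => z 0 a).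
Proof.
apply: (@smooth_linear _ _ (fun b => (delta_mx 0 b : 'rV[R]_3) 0 a)).
  exact: coord_continuous.
by move=> x b; exact: is_derive_coord.
Qed.

(** The balls with rational centres and radii 1 / (n + 1) form a basis. *)
Lemma rV3_second_countable : @second_countable 'rV[R]_3.
Proof.
pose B (p : 'rV[rat]_3 * nat) : set 'rV[R]_3 := ball (map_mx ratr p.1 : 'rV[R]_3) (p.2.+1%:R^-1).
exists (range B); first by apply: card_le_trans (card_image_le _ _) _; exact: countableP.
split=> [_ [p _ <-]|x U]; first by apply: ball_open; rewrite invr_gt0.
move=> /nbhs_ballP[e /= e0 xU].
pose n := Num.truncn (2 / e); pose r : R := n.+1%:R^-1.
have r0 : 0 < r by rewrite invr_gt0.
have re : r + r < e.
  have /andP[_] : n%:R <= 2 / e < n.+1%:R by rewrite truncn_itv // divr_ge0 // ltW.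
  rewrite ltr_pdivrMr // mulrC -ltr_pdivrMr // => rE.
  by rewrite -mulr2n -mulr_natl.
have q_ a : exists q : rat, `|x 0 a - ratr q| < r.
  have [|q] := @rat_in_itvoo R (x 0 a - r) (x 0 a + r); first by rewrite ltrD2l gtrN.
  rewrite in_itv /= => /andP[q1 q2]; exists q.
  by rewrite ltr_norml; apply/andP; split; lra.
pose q : 'rV[rat]_3 := \row_a sval (cid (q_ a)).
have xq : ball x r (map_mx ratr q : 'rV[R]_3).
  split=> // a b; rewrite (ord1 a) !mxE -ball_normE /=; exact: (svalP (cid (q_ b))).
exists (B (q, n)); last first.
  move=> y qy; apply: xU; apply: (le_ball (ltW re)).
  exact: ball_triangle xq qy.
by split; [exists (q, n) | apply: ball_sym].
Qed.

Definition euclidean : manifold3 R.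
Proof.
refine (@Manifold3 R 'rV[R]_3 (@norm_hausdorff _ _) rV3_second_countable unit
  (fun=> setT) (fun=> setT) (fun=> id) (fun=> id) _ _ _ _ _ _ _ _ _ _).
- by move=> _; exact: openT.
- by move=> _; exact: openT.
- by [].
- by [].
- by [].
- by [].
- by move=> _ p _; exact: cvg_id.
- by move=> _ p _; exact: cvg_id.
- by move=> p; exists tt.
- by move=> _ _ a; exact: smooth_coord.
Defined.

Lemma euclidean_jac x a b : jac (M := euclidean) tt tt x a b = kron R a b.
Proof.
rewrite /jac (partialE (is_derive_coord x (delta_mx 0 b) a)) mxE eqxx.
by rewrite /kron eq_sym.
Qed.

Lemma euclidean_hess x a b c : hess (M := euclidean) tt tt x a b c = 0.
Proof.
rewrite /hess (_ : partial c _ = cst ((delta_mx 0 c : 'rV[R]_3) 0 a)) /partial ?derive_cst //.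
by apply/funext => z; apply: partialE; exact: is_derive_coord.
Qed.

Lemma sum_kron_l (F : 'I_3 -> R) a : \sum_e kron R a e * F e = F a.
Proof.
by rewrite -[RHS]sum_kron; apply: eq_bigr => e _; rewrite mulrC /kron eq_sym.
Qed.

Lemma sum_kron3 (F : 'I_3 -> 'I_3 -> 'I_3 -> R) a b c :
  \sum_d \sum_e \sum_f kron R a d * kron R b e * kron R c f * F d e f = F a b c.
Proof.
rewrite -(sum_kron_l (fun d => F d b c) a); apply: eq_bigr => d _.
rewrite -(sum_kron_l (fun e => F d e c) b) mulr_sumr; apply: eq_bigr => e _.
rewrite -(sum_kron_l (fun f => F d e f) c) !mulr_sumr; apply: eq_bigr => f _.
by rewrite !mulrA.
Qed.

Lemma sum_kron2 (F : 'I_3 -> 'I_3 -> R) a b :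
  \sum_d \sum_e F d e * kron R d a * kron R e b = F a b.
Proof.
rewrite -(sum_kron (fun d => F d b) a); apply: eq_bigr => d _.
by rewrite sum_kron.
Qed.

Definition standard_trivector : volume_trivector euclidean.
Proof.
refine (@VolumeTrivector R euclidean (fun _ _ => eta R) _ _ _ _ _).
- by move=> *; exact: smooth_cst.
- move=> [] [] x a b c _; rewrite -(sum_kron3 (eta R) a b c).
  apply: eq_bigr => d _; apply: eq_bigr => e _; apply: eq_bigr => f _.
  by rewrite !euclidean_jac.
- move=> [] x a b c _.
  by elim/ord3_ind: a; elim/ord3_ind: b; elim/ord3_ind: c; rewrite /eta /= ?opprK ?oppr0.
- move=> [] x a b c _.
  by elim/ord3_ind: a; elim/ord3_ind: b; elim/ord3_ind: c; rewrite /eta /= ?opprK ?oppr0.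
- by move=> [] x _; exists o0, o1, o2; rewrite /eta /= oner_neq0.
Defined.

(** [gamma_coef1] and [gamma_coef2] are the coefficients of the second and
third coordinates in the Christoffel symbols. They are chosen so that at the
origin, where the quadratic terms of the curvature vanish, the curvature is
Ricci-flat and R_23^b_c is diagonal with entries 1, 1, -2. With entries
1, -1, 0 or -2, 1, 1 the value of T on the first covector would be zero. *)
Definition gamma_coef1 (a b c : 'I_3) : R :=
  match nat_of_ord a, nat_of_ord b, nat_of_ord c with
  | 0, 2, 0 | 2, 0, 0 => 2
  | 2, 2, 2 => -2
  | _, _, _ => 0
  end.

Definition gamma_coef2 (a b c : 'I_3) : R :=
  match nat_of_ord a, nat_of_ord b, nat_of_ord c with
  | 0, 1, 0 | 1, 0, 0 => 1
  | 1, 1, 1 => -1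
  | _, _, _ => 0
  end.

Definition gamma (z : 'rV[R]_3) (a b c : 'I_3) : R :=
  gamma_coef1 a b c * z 0 o1 + gamma_coef2 a b c * z 0 o2.

Lemma is_derive_gamma x e a b c :
  is_derive x (delta_mx 0 e : 'rV[R]_3) (fun z => gamma z a b c)
    (gamma_coef1 a b c * kron R o1 e + gamma_coef2 a b c * kron R o2 e).
Proof.
have k j : kron R j e = (delta_mx 0 e : 'rV[R]_3) 0 j by rewrite mxE eqxx.
rewrite !k; exact: (is_derive_fun_add (is_derive_fun_scale _ (is_derive_coord _ _ _))
  (is_derive_fun_scale _ (is_derive_coord _ _ _))).
Qed.

Definition sample_connection : connection euclidean.
Proof.
refine (@Connection R euclidean (fun _ => gamma) _ _).
- move=> i a b c.
  apply: (@smooth_linear _ _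
    (fun e => gamma_coef1 a b c * kron R o1 e + gamma_coef2 a b c * kron R o2 e)).
    move=> x; apply: (@continuousD R R _ (fun z : 'rV[R]_3 => gamma_coef1 a b c * z 0 o1)
      (fun z : 'rV[R]_3 => gamma_coef2 a b c * z 0 o2)).
      by apply: continuousM; [exact: cst_continuous | exact: coord_continuous].
    by apply: continuousM; [exact: cst_continuous | exact: coord_continuous].
  by move=> x e; exact: is_derive_gamma.
- move=> [] [] x a b f _; rewrite euclidean_hess add0r.
  under eq_bigr do rewrite euclidean_jac.
  rewrite sum_kron_l -[LHS](sum_kron2 (fun d e => gamma x d e f)).
  by apply: eq_bigr => d _; apply: eq_bigr => e _; rewrite !euclidean_jac.
Defined.

Lemma sample_torsion_free : torsion_free sample_connection.
Proof.
move=> i x a b c _; rewrite /sample_connection /= /gamma.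
by elim/ord3_ind: a; elim/ord3_ind: b; elim/ord3_ind: c.
Qed.

Lemma sample_curvature a b c d : curvature sample_connection tt 0 a b c d =
  (gamma_coef1 b d c * kron R o1 a + gamma_coef2 b d c * kron R o2 a)
  - (gamma_coef1 a d c * kron R o1 b + gamma_coef2 a d c * kron R o2 b).
Proof.
rewrite /curvature /= !(partialE (is_derive_gamma _ _ _ _ _)) big1 ?addr0 // => e _.
have g0 p q r : gamma 0 p q r = 0 by rewrite /gamma !mxE !mulr0 addr0.
by rewrite !g0 !mulr0 subr0.
Qed.

Lemma sample_weyl a b c d :
  weyl_of sample_connection tt 0 a b c d = curvature sample_connection tt 0 a b c d.
Proof.
have ric p q : ricci sample_connection tt 0 p q = 0.
  rewrite /ricci sum3 !sample_curvature.
  elim/ord3_ind: p; elim/ord3_ind: q; rewrite /gamma_coef1 /gamma_coef2 /kron /=; ring.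
rewrite /weyl_of /weyl_remainder /projective_schouten !ric mulr0 addr0 mul0r; ring.
Qed.

(** On the first covector e the matrix M_e is diag(2, 2, -4), so e is an
eigenvector and v, u, w are multiples of it; T(e) reduces to a polynomial in
the power sums 24 and -48 of the eigenvalues, with value -48^3. *)
Lemma sample_obstruction :
  tT (Vtensor standard_trivector (weyl_of sample_connection) tt 0) (fun=> o0) <> 0.
Proof.
set V := Vtensor _ _ _ _; pose e : 'rV[R]_3 := delta_mx 0 o0.
rewrite -evaluate_frame evaluate_tT -/e.
have mE : contraction V e = diag_mx (\row_j (if j == o2 then -4 else 2)).
  apply/matrixP => b c; rewrite !mxE (bigD1 o0) //= big1 => [|a ne]; last first.
    by rewrite mxE (negbTE ne) mul0r.
  rewrite mxE addr0 mul1r /V /Vtensor !sum3 /= !sample_weyl !sample_curvature.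
  elim/ord3_ind: b; elim/ord3_ind: c; rewrite /eta /gamma_coef1 /gamma_coef2 /kron /=; ring.
have MZ k : contraction V (k *: e) = k *: contraction V e.
  apply/matrixP => b c; rewrite !mxE mulr_sumr; apply: eq_bigr => a _.
  by rewrite !mxE mulrA.
have em : e *m contraction V e = 2 *: e.
  rewrite mE -rowE; apply/rowP => j; rewrite !mxE.
  by elim/ord3_ind: j; rewrite /= ?mulr1 ?mulr0 ?mulr0n.
have t2 : \tr (contraction V e *m contraction V e) = 24.
  by rewrite mE mulmx_diag mxtrace_diag sum3 !mxE /=; ring.
have t3 : \tr (contraction V e *m contraction V e *m contraction V e) = - 48.
  by rewrite mE !mulmx_diag mxtrace_diag sum3 !mxE /=; ring.
rewrite /obstruction_form em !MZ -!(scalemxAl, scalemxAr) em !scalerA !MZ.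
rewrite -!(scalemxAl, scalemxAr) !scalerA !mxtraceZ em scalerA MZ -scalemxAl mxtraceZ t2 t3.
move=> T0; have : - 48 ^+ 3 = 0 :> R by rewrite -[RHS]T0; ring.
by move/eqP; rewrite oppr_eq0 expf_eq0 pnatr_eq0.
Qed.
End Example.

(** * Metrisability *)

Theorem theorem1p1 (R : realType) :
  (forall (M : manifold3 R) (eps : volume_trivector M) (N : connection M)
          (W : chart M -> 'rV[R]_3 -> 'I_3 -> 'I_3 -> 'I_3 -> 'I_3 -> R),
      torsion_free N -> is_projective_weyl N W ->
      forall (i : chart M) (x : 'rV[R]_3), cod i x ->
        (forall a b c : 'I_3,
            Vtensor eps W i x a b c = Vtensor eps W i x b a c) /\
        (forall b : 'I_3, \sum_(a < 3) Vtensor eps W i x a b a = 0)) /\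
  (exists (M : manifold3 R) (eps : volume_trivector M) (N : connection M)
          (W : chart M -> 'rV[R]_3 -> 'I_3 -> 'I_3 -> 'I_3 -> 'I_3 -> R),
      torsion_free N /\ is_projective_weyl N W /\
      exists (i : chart M) (x : 'rV[R]_3) (k : 'I_6 -> 'I_3),
        cod i x /\ tT (Vtensor eps W i x) k <> 0) /\
  (forall (M : manifold3 R) (eps : volume_trivector M) (N : connection M)
          (W : chart M -> 'rV[R]_3 -> 'I_3 -> 'I_3 -> 'I_3 -> 'I_3 -> R),
      torsion_free N -> is_projective_weyl N W ->
      (exists (g : metric M) (LC : connection M),
          levi_civita g LC /\ projectively_equivalent N LC) ->
      forall (i : chart M) (x : 'rV[R]_3) (k : 'I_6 -> 'I_3),
        cod i x -> tT (Vtensor eps W i x) k = 0).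
Proof.
split=> [M eps N W tN NW i x xi|].
  by split=> *; [exact: (Vtensor_sym eps tN NW xi) | exact: (Vtensor_trace eps tN NW xi)].
split.
  exists (euclidean R), (standard_trivector R), (sample_connection R).
  exists (weyl_of (sample_connection R)); split; first exact: sample_torsion_free.
  split; first exact: (weyl_ofP (@sample_torsion_free R)).
  by exists tt, 0, (fun=> o0); split=> //; exact: sample_obstruction.
move=> M eps N W tN NW [g [LC [gLC NLC]]] i x k xi.
have [G [H [symG symH VE]]] := Vtensor_pencil eps tN NW xi gLC NLC.
by rewrite (tT_pencil symG symH VE).
Qed.
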